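(* There exist real constants $C$ and $D$ such that for every finite solvable group $G$ and every irreducible complex character $\chi \in \operatorname{Irr}(G)$, $$\operatorname{dl}(G/\operatorname{Ker}(\chi)) \leq C\,\eta(\chi) + D.$$
   Context: $\operatorname{Irr}(G)$ is the set of irreducible complex characters of the finite group $G$, $1_G$ is the principal character, and $\overline{\chi}$ is the complex conjugate of $\chi$. $\operatorname{dl}$ denotes derived length. $\operatorname{Ker}(\chi)=\{g\in G : \chi(g)=\chi(1)\}$. For $\chi\in\operatorname{Irr}(G)$, $\eta(\chi)$ denotes the number of distinct non-principal irreducible constituents of the character $\chi\overline{\chi}$ (so $\eta(\chi)=0$ if $\chi(1)=1$). *)

(* Defs.v *)
From mathcomp Require Export all_boot all_order all_algebra all_fingroup.
From mathcomp Require Export all_solvable all_field all_character reals.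

Set Implicit Arguments.
Unset Strict Implicit.
Unset Printing Implicit Defensive.

Import GroupScope GRing.Theory.

(* Same encoding as nil_class: the first n with A^`(n) = 1, searched below the
   bound #|A|. This is the derived length when A is a solvable group (see
   derived_length_leP); for a nonsolvable group the value #|A| is junk. *)
Definition derived_length (gT : finGroupType) (A : {set gT}) : nat :=
  index 1 (mkseq (fun n => A^`(n)) #|A|).

Lemma derived_length_leP (gT : finGroupType) (G : {group gT}) (n : nat) :
  solvable G -> reflect (G^`(n) = 1) (derived_length G <= n).
Proof.
move=> solG; rewrite /derived_length; set s := mkseq _ _.
have bnd m : #|G^`(m)| <= (#|G|.-1 - m).+1.
  elim: m => [|m IHm]; first by rewrite subn0 prednK.
  rewrite dergSn subnS -ltnS.
  have [-> | ntGm] := eqVneq G^`(m) 1; first by rewrite commG1 cards1.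
  case: (_ - _) IHm => [|m']; first by rewrite leqNgt cardG_gt1 ntGm.
  by apply: leq_trans (proper_card _); apply: sol_der1_proper (der_sub _ _) _.
have s1 : 1 \in s.
  apply/mapP; exists #|G|.-1; first by rewrite mem_iota /= add0n prednK.
  by rewrite [G^`(_)]card_le1_trivg // (leq_trans (bnd _)) ?subnn.
have lt_c : index 1 s < #|G|.
  by rewrite -[leqRHS](size_mkseq (fun m => G^`(m))) index_mem.
case: leqP => [le_c_n | lt_n_c].
  have Gc1 : nth 1 s (index 1 s) = 1 by rewrite nth_index.
  left; apply/trivgP; rewrite -Gc1 nth_mkseq //.
  rewrite -(subnK le_c_n); elim: (n - _) => [|m IHm] //.
  by rewrite addSn (subset_trans _ IHm) ?der_subS.
right; apply/eqP/negPf; rewrite -(before_find 1 lt_n_c) nth_mkseq //.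
exact: ltn_trans lt_n_c lt_c.
Qed.

(* 'chi_0 = 1 is the principal character (irr0), so i != 0 selects the
   non-principal constituents. *)
Definition eta (gT : finGroupType) (G : {group gT}) (chi : 'CF(G)) : nat :=
  #|[set i : Iirr G | (i \in irr_constt (chi * chi^*%CF)%R) & (i != 0%R)]|.

(* Main.v *)
Require Import Defs.
From mathcomp Require Import zify.

Set Implicit Arguments.
Unset Strict Implicit.
Unset Printing Implicit Defensive.

Import Order.TTheory GroupScope GRing.Theory Num.Theory.

(** The proof rests on the linear bound for modules: if a solvable group [G]
    acts irreducibly on a finite vector space [V] with [O] orbits, then
    [G^(600 O)] acts trivially.  If some maximal abelian normal subgroup [A] of
    [G] (acting faithfully) is not homogeneous on [V], then the [k] homogeneous
    components are permuted by a solvable group of derived length at most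
    [3 (k - 1)], and vectors of support size [2, ..., k] provide [k - 1] orbits
    besides those met by one component, so one can induct.  Otherwise [A] spans
    a field [E], with [|V| = |E|^d], and if [B/A] is a maximal abelian normal
    subgroup of [G/A] inside [C_G(A)/A], then the cosets of [A] in [B] are
    linearly independent over [E], whence [N = |B : A| <= d^2], while [|G|] is at
    most [|E|^2 (N^2)^(log N)] and the derived length of [G] is polynomial in
    [log N]; counting [|V| <= O |G|] then makes [O] exponential in [d].

    For a normal subgroup [L] let [S(L)] be the set of nonprincipal constituents
    of [chi * chi^*] with [L] in their kernel, and suppose that [L] is the
    intersection of the kernels of [S(L)].  Let [E/L] be a chief factor, [K] the
    intersection of the kernels of [S(E)], and [C] the centralizer of [E/L] in
    [K].  Constituents of [chi] on groups between [E] and [K] remain irreducible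
    on [E], which forces [C' <= L].  If [K] moves [E/L], then some constituent
    [phi] of [chi] on [E] is stabilized by a nontrivial linear character of
    [E/L]; this yields a [K]-invariant [R < E] such that every character of [E/R]
    lies under [S(L)] or is trivial, and Brauer's permutation lemma together with
    the bound for modules, applied to [N_G(R)] acting on [E/R], bounds the derived
    length of [K/C] linearly in [|S(L)| - |S(E)|].  Summing up a chain of such
    subgroups from [G] down to the intersection of the kernels of [S(1)], which
    is central modulo [Ker chi], gives the theorem. *)

(** * Index bounds and derived series *)

Lemma der_subn (gT : finGroupType) (A : {group gT}) m n :
  m <= n -> A^`(n) \subset A^`(m).
Proof.
move/subnK <-; elim: (n - m)%N => [|k IHk]; first by rewrite add0n.
by rewrite addSn (subset_trans (der_subS _ _)).
Qed.

Lemma der_derived (gT : finGroupType) (A : {group gT}) m n :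
  A^`(m + n) = [group of A^`(m)]^`(n).
Proof. by elim: n => [|n IHn]; rewrite ?addn0 // addnS !dergSn IHn. Qed.

Lemma der_comp_sub (gT : finGroupType) (A B C : {group gT}) m n :
  A^`(m) \subset B -> B^`(n) \subset C -> A^`(m + n) \subset C.
Proof. by move=> sAB; rewrite der_derived; apply: subset_trans (dergS _ sAB). Qed.

(** While nontrivial, each derived subgroup of a solvable group has at most half the order of the
    previous one, so a nontrivial [n]-th term would force [#|A| >= 2 ^ n.+1]. *)
Lemma sol_der_card (gT : finGroupType) (A : {group gT}) n :
  solvable A -> #|A| < 2 ^ n.+1 -> A^`(n) = 1.
Proof.
move=> solA ltA; apply/eqP/idPn => ntAn.
have: 2 ^ n * #|A^`(n)| <= #|A|.
  elim: n {ltA} ntAn => [|n IHn] ntAn; first by rewrite mul1n.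
  have ntAn': A^`(n) != 1.
    by apply: contraNneq ntAn => An1; rewrite dergSn An1 commG1.
  apply: leq_trans (IHn ntAn'); rewrite expnSr -mulnA leq_mul2l; apply/orP; right.
  have prA: A^`(n.+1) \proper A^`(n) by apply: (sol_der1_proper solA (der_sub n A)).
  have := Lagrange (proper_sub prA); rewrite mulnC => <-.
  by rewrite leq_mul2r indexg_gt1 proper_subn ?orbT.
rewrite leqNgt (leq_trans ltA) // expnSr leq_mul2l.
by rewrite cardG_gt1 ntAn orbT.
Qed.

Lemma sol_der_index (gT : finGroupType) (A K : {group gT}) n :
  solvable A -> K <| A -> #|A : K| < 2 ^ n.+1 -> A^`(n) \subset K.
Proof.
move=> solA nsKA ltAK; have nKA := normal_norm nsKA.
rewrite -quotient_sub1 ?(subset_trans (der_sub _ _)) // quotient_der //.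
by rewrite sol_der_card ?quotient_sol // card_quotient.
Qed.

(** Adjoining to [A] an element of [B] outside the subgroup reached so far at least doubles that
    subgroup. *)
Lemma gen_index_log (gT : finGroupType) (A B : {group gT}) :
  A \subset B ->
  exists X : {set gT}, [/\ X \subset B, <<A :|: X>> = B & 2 ^ #|X| <= #|B : A|].
Proof.
have [m] := ubnP #|B : A|; elim: m A => // m IHm A ltm sAB.
have [sBA | /subsetPn[x Bx notAx]] := boolP (B \subset A).
  have eqAB: A :=: B by apply/eqP; rewrite eqEsubset sAB.
  by exists set0; rewrite sub0set setU0 cards0 genGid indexg_gt0.
pose A1 := <<x |: A>>%G.
have sA1B: A1 \subset B by rewrite gen_subG subUset sub1set Bx.
have sAA1: A \subset A1 by rewrite (subset_trans _ (subset_gen _)) ?subsetUr.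
have A1x: x \in A1 by rewrite mem_gen ?setU11.
have gt1: 1 < #|A1 : A|.
  by rewrite indexg_gt1; apply: contra notAx => /subsetP->.
have iBA := Lagrange_index sA1B sAA1.
have ltA1: #|B : A1| < m.
  rewrite -ltnS; apply: leq_trans ltm; rewrite ltnS -iBA ltn_Pmulr //.
have [X [sXB genX leX]] := IHm A1 ltA1 sA1B.
exists (x |: X); split; first by rewrite subUset sub1set Bx.
  apply/eqP; rewrite eqEsubset gen_subG !subUset sub1set sAB Bx sXB /=.
  rewrite -genX gen_subG subUset gen_subG subUset sub1set mem_gen ?inE ?eqxx ?orbT //=.
  by rewrite !sub_gen //; apply/subsetP=> y; rewrite !inE => ->; rewrite ?orbT.
rewrite -iBA mulnC (leq_trans (_ : _ <= 2 * 2 ^ #|X|)) ?leq_mul //.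
by rewrite -expnS leq_pexp2l // cardsU1; case: (_ \notin _).
Qed.

Lemma index_cent_bound (gT : finGroupType) (A : {group gT}) (X : {set gT}) M :
  (forall x, x \in X -> #|x ^: A| <= M) -> #|A : 'C_A(X)| <= M ^ #|X|.
Proof.
have [n] := ubnP #|X|; elim: n X => // n IHn X ltX leM.
have [-> | [x Xx]] := set_0Vmem X.
  by rewrite cards0 expn0 (setIidPl _) ?indexgg // centsC sub0set.
have X'lt: #|X :\ x| < n by rewrite (cardsD1 x) Xx in ltX.
have leX' y: y \in X :\ x -> #|y ^: A| <= M by case/setD1P=> _ /leM.
have {IHn}le1 := IHn _ X'lt leX'; rewrite (cardsD1 x X) Xx expnS.
rewrite -{1}(setD1K Xx) centU setIA.
have sub: 'C_A(X :\ x) :&: 'C_A([set x]) \subset 'C_A(X :\ x) by apply: subsetIl.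
have ->: A :&: 'C([set x]) :&: 'C(X :\ x) = 'C_A(X :\ x) :&: 'C[x].
  by rewrite cent_set1 setIAC.
have iA := Lagrange_index (subsetIl A 'C(X :\ x)) (subsetIl 'C_A(X :\ x) 'C[x]).
rewrite -iA mulnC leq_mul // index_cent1 (leq_trans _ (leM x Xx)) //.
by apply/subset_leq_card/imsetS/subsetIl.
Qed.

(** The action on [N] is determined by the images of at most [l] generators, so ['C_A(N)] has index
    at most [#|N| ^ l] in [A], and this is less than [2 ^ (l * l.+1).+1]. *)
Lemma der_cent_log (gT : finGroupType) (A N : {group gT}) (l := trunc_log 2 #|N|) :
  solvable A -> A \subset 'N(N) -> A^`(l * l.+1) \subset 'C(N).
Proof.
move=> solA nNA; have [X [sXN genX leX]] := gen_index_log (sub1G N).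
have defCN: 'C_A(X) = 'C_A(N).
  by rewrite -genX cent_gen centU cent1T setTI.
rewrite indexg1 in leX.
have leXl: #|X| <= l by apply: trunc_log_max.
have ltN: #|N| < 2 ^ l.+1 by apply: trunc_log_ltn.
have leA: #|A : 'C_A(N)| <= #|N| ^ l.
  rewrite -defCN; apply: leq_trans (index_cent_bound (M := #|N|) _) _ => [x Xx|].
    by rewrite subset_leq_card // class_sub_norm // (subsetP sXN).
  by rewrite leq_pexp2l.
have nsC: 'C_A(N) <| A by rewrite /normal subsetIl normsI ?normG ?norms_cent.
apply: subset_trans (subsetIr A _); apply: sol_der_index => //.
apply: leq_ltn_trans leA _; apply: leq_ltn_trans (_ : 2 ^ (l.+1 * l) < _).
  by rewrite expnM; case: (posnP l) => [->|l0] //; rewrite leq_exp2r // ltnW.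
by rewrite ltn_exp2l // mulnC.
Qed.

Lemma sol_last_der (gT : finGroupType) (Y A : {group gT}) :
  solvable Y -> ~~ (Y \subset A) ->
  exists j, ~~ (Y^`(j) \subset A) /\ Y^`(j.+1) \subset A.
Proof.
move=> solY notYA; have exj : exists n, Y^`(n) \subset A.
  by have /derivedP[n Yn1] := solY; exists n; rewrite Yn1 sub1G.
case: (ex_minnP exj) => [[|j] sYjA minj]; first by rewrite sYjA in notYA.
by exists j; split=> //; apply/negP=> /minj; rewrite ltnn.
Qed.

Lemma card_Ldiv_cyclic (gT : finGroupType) (A : {group gT}) n :
  cyclic A -> 0 < n -> #|'Ldiv_n(A)| <= n.
Proof.
move=> cycA n0; pose L := Group (group_Ldiv n (cyclic_abelian cycA)).
have sLA : L \subset A by apply: subsetIl.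
have /cyclicP[z defL] := cyclicS sLA cycA.
have Lz : z \in L by rewrite defL cycle_id.
have zn : z ^+ n = 1 by move: Lz; rewrite !inE => /andP[_ /eqP].
by rewrite -[#|_|]/#|L| defL -orderE dvdn_leq // order_dvdn zn.
Qed.

(** * Solvable groups with a cyclic maximal abelian normal subgroup *)

Section MaximalAbelianNormal.

Variables (gT : finGroupType) (G A : {group gT}).
Hypotheses (solG : solvable G) (nsAG : A <| G) (cycA : cyclic A).
Hypothesis maxA : forall H : {group gT},
  H <| G -> abelian H -> A \subset H -> H \subset A.

Let C := 'C_G(A)%G.
Let abA := cyclic_abelian cycA.
Let sAG := normal_sub nsAG.
Let nAG := normal_norm nsAG.

Let nsCG : C <| G.
Proof. by rewrite /normal subsetIl normsI ?normG ?norms_cent. Qed.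

Let sAC : A \subset C. Proof. by rewrite subsetI sAG. Qed.

(** [G / C] embeds in the automorphism group of a cyclic group, which is abelian. *)
Lemma der1_cent_cyclic : G^`(1) \subset C.
Proof.
rewrite subsetI der_sub /= -ker_conj_aut ker_trivg_morphim.
rewrite (subset_trans (der_sub _ _) nAG) /= morphim_der //.
apply/trivgP/derG1P; apply: abelianS (Aut_cyclic_abelian cycA).
exact: Aut_conj_aut.
Qed.

Lemma index_cent_cyclic : #|G : C| <= #|A|.
Proof.
have /cyclicP[a defA] := cycA.
rewrite /C /= defA cent_cycle index_cent1 -defA subset_leq_card //.
by rewrite class_sub_norm // defA cycle_id.
Qed.

Variable B : {group gT}.
Hypotheses (sAB : A \subset B) (sBC : B \subset C) (nsBG : B <| G).
Hypothesis sB'A : [~: B, B] \subset A.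
Hypothesis maxB : forall H : {group gT}, H <| G -> B \subset H -> H \subset C ->
  [~: H, H] \subset A -> H \subset B.

Let sBG := normal_sub nsBG.
Let cAB : B \subset 'C(A). Proof. exact: subset_trans sBC (subsetIr _ _). Qed.
Let nAB : B \subset 'N(A). Proof. exact: cents_norm cAB. Qed.

Lemma center_sub_abelian : 'Z(B) \subset A.
Proof.
apply: maxA; [exact: gFnormal_trans | exact: center_abelian |].
by rewrite subsetI sAB centsC.
Qed.

(** Otherwise let [D] be the last derived subgroup of ['C_C(B)] outside [A]. As [D] centralizes [B],
    the product [B D] is abelian modulo [A], so maximality of [B] puts [D] in ['Z(B)], which lies in
    [A]. *)
Lemma cent_class2_sub : 'C_C(B) \subset A.
Proof.
pose Y := 'C_C(B)%G; apply/negPn/negP=> notYA.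
have sYC : Y \subset C := subsetIl _ _.
have nsYG : Y <| G.
  rewrite /normal (subset_trans sYC) ?subsetIl // normsI ?norms_cent //.
    exact: normal_norm.
  exact: normal_norm.
have solY : solvable Y := solvableS (normal_sub nsYG) solG.
have [j [notDA sD'A]] := sol_last_der solY notYA.
pose D := [group of Y^`(j)].
have sDY : D \subset Y := der_sub j Y.
have nsDG : D <| G by apply: gFnormal_trans.
have cBD : D \subset 'C(B) := subset_trans sDY (subsetIr _ _).
have nAD : D \subset 'N(A) := subset_trans (normal_sub nsDG) nAG.
pose J := (B <*> D)%G.
have sJC : J \subset C by rewrite join_subG sBC (subset_trans sDY).
have nAJ : J \subset 'N(A) by rewrite join_subG nAB.
have sJ'A : [~: J, J] \subset A.
  apply: (der1_min nAJ); rewrite /= cent_joinEr // quotientMl // abelianM.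
  rewrite quotient_cents // sub_der1_abelian //= andbT.
  exact: sub_der1_abelian.
have sJB : J \subset B by apply: maxB; rewrite ?normalY ?joing_subl.
case/negP: notDA; apply: subset_trans center_sub_abelian.
by rewrite subsetI cBD andbT (subset_trans (joing_subr B D)).
Qed.

Let N := #|B : A|.
Let l := trunc_log 2 N.

(* Two conjugates of [x] in the same coset of [A] differ by an element of [A] of
   exponent [N], because [C] fixes their [N]-th powers, which lie in [A]. *)
Lemma card_class_class2 x : x \in B -> #|x ^: C| <= N * N.
Proof.
move=> Bx; have sxB : x ^: C \subset B.
  by rewrite class_sub_norm // (subset_trans (subsetIl _ _)) ?normal_norm.
have expN y : y \in B -> y ^+ N \in A.
  move=> By; apply: coset_idr; first by rewrite (subsetP nAB) ?groupX.
  have Ny := subsetP nAB y By.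
  rewrite morphX //; apply/eqP; rewrite -order_dvdn /N -card_quotient //.
  by rewrite order_dvdG // mem_quotient.
pose f (p : {set gT} * gT) := repr (p.1 :&: x ^: C) * p.2.
have sub : x ^: C \subset f @: setX (rcosets A B) 'Ldiv_N(A).
  apply/subsetP=> y xCy; have By := subsetP sxB y xCy.
  pose r := repr (A :* y :&: x ^: C).
  have /setIP[/rcosetP[a Aa def_r] xCr] : r \in A :* y :&: x ^: C.
    by apply: mem_repr (y) _; rewrite inE rcoset_refl.
  apply/imsetP; exists (A :* y, r^-1 * y); last by rewrite /f /= -/r mulKVg.
  have cya : commute y a by apply: (centP (subsetP cAB y By)).
  have cyV : commute y a^-1 by apply: commuteV.
  have -> : r^-1 * y = a^-1 by rewrite def_r invMg -mulgA -cyV mulKg.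
  rewrite !inE /= mem_rcosets mulSGid // By groupV Aa /= expgVn eq_invg1.
  have [/imsetP[c Cc def_rx] /imsetP[d Cd def_yx]] := (xCr, xCy).
  have cce e : e \in C -> (x ^+ N) ^ e = x ^+ N.
    case/setIP=> _ cAe; apply/conjg_fixP/commgP.
    by apply/commute_sym/(centP cAe)/expN.
  have: r ^+ N = y ^+ N by rewrite -/r in def_rx; rewrite def_rx def_yx -!conjXg !cce.
  rewrite def_r expgMn; last exact: commute_sym.
  by move/eqP; rewrite -{2}[y ^+ N]mul1g (inj_eq (mulIg _)).
apply: leq_trans (subset_leq_card sub) _; apply: leq_trans (leq_imset_card _ _) _.
by rewrite cardsX leq_mul // card_Ldiv_cyclic // indexg_gt0.
Qed.

(** At most [l] elements generate [B] over [A]. Since [C] centralizes [A], their common centralizer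
    in [C] is ['C_C(B)], which lies in [A]. *)
Lemma index_cent_class2 : #|C : A| <= (N * N) ^ l.
Proof.
have [X [sXB genX leX]] := gen_index_log sAB.
have sCA : 'C_C(X) \subset A.
  apply: subset_trans cent_class2_sub; rewrite subsetI subsetIl /= -genX.
  by rewrite cent_gen centU subsetI subsetIr (subset_trans (subsetIl _ _)) ?subsetIr.
have leXl : #|X| <= l by apply: trunc_log_max.
apply: leq_trans (dvdn_leq (indexg_gt0 _ _) (indexgS C sCA)) _.
apply: leq_trans (index_cent_bound (M := (N * N)%N) _) _ => [x Xx|].
  by apply: card_class_class2; rewrite (subsetP sXB).
by rewrite leq_pexp2l // muln_gt0 indexg_gt0.
Qed.

(** One step leads from [G] into [C], and [l * l.+1] more lead to a subgroup [H] centralizing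
    [B / A]. Then [[H, B]] lies in [A], which [H] centralizes, so by the three subgroups lemma [H']
    centralizes [B] and lies in the abelian group [A]. *)
Lemma der_class2 : G^`(l * l.+1 + 3) = 1.
Proof.
have nAC : C \subset 'N(A) := subset_trans (subsetIl _ _) nAG.
have solC : solvable C := solvableS (subsetIl _ _) solG.
pose H := [group of C^`(l * l.+1)].
have sHC : H \subset C := der_sub _ _.
have sHBA : [~: H, B] \subset A.
  rewrite -quotient_cents2 ?(subset_trans sHC) // quotient_der // /l /N -card_quotient //.
  apply: der_cent_log; first exact: quotient_sol.
  by rewrite quotient_norms // (subset_trans (subsetIl _ _)) ?normal_norm.
have cHA : [~: A, H] = 1.
  by apply/commG1P; rewrite centsC (subset_trans sHC) ?subsetIr.
have sH'A : H^`(1) \subset A.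
  apply: subset_trans cent_class2_sub.
  rewrite subsetI (subset_trans (der_sub _ _) sHC) /=.
  apply/commG1P/three_subgroup; apply/trivgP; rewrite -cHA.
    by rewrite commSg.
  by rewrite [[~: B, H]]commGC commSg.
have sA1 : A^`(1) \subset [1] by apply/trivgP/derG1P.
have -> : (l * l.+1 + 3 = 1 + l * l.+1 + 1 + 1)%N.
  by move: (l * l.+1)%N => q; rewrite -!addnA addnCA addnC.
apply/trivgP.
exact: (der_comp_sub (der_comp_sub (der_comp_sub der1_cent_cyclic (subxx H)) sH'A) sA1).
Qed.

End MaximalAbelianNormal.

Local Open Scope nat_scope.

(** * Permutation groups *)

Lemma quadratic_exp_bound l : 0 < l -> l * l.+1 + 1 <= 3 * (2 ^ l).-1.
Proof.
case: l => // l _; elim: l => // l IHl.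
have := ltn_expl l.+1 (isT : 1 < 2); rewrite (expnS 2 l.+1); move: IHl.
set X := 2 ^ l.+1; nia.
Qed.

Lemma quadratic_log_bound k : 1 < k ->
  trunc_log 2 k * (trunc_log 2 k).+1 + 1 <= 3 * k.-1.
Proof.
move=> k1; have l0 : 0 < trunc_log 2 k by rewrite trunc_log_gt0.
apply: leq_trans (quadratic_exp_bound l0) _.
by rewrite leq_mul2l -!subn1 leq_sub2r // trunc_logP // ltnW.
Qed.

Section NormalOrbits.

Variables (aT : finGroupType) (D : {group aT}) (T : finType) (to : action D T).
Variables (G N : {group aT}).
Hypotheses (sGD : G \subset D) (nNG : G \subset 'N(N)) (sNG : N \subset G).

Lemma setact_orbit_norm x a :
  a \in G -> to^*%act (orbit to N x) a = orbit to N (to x a).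
Proof.
have sub y b : b \in G -> to^*%act (orbit to N y) b \subset orbit to N (to y b).
  move=> Gb; apply/subsetP=> _ /imsetP[_ /orbitP[c Nc <-] ->].
  have [Gc Dy] := (subsetP sNG c Nc, subsetP sGD).
  rewrite -actMin ?Dy // [(c * b)%g]conjgC actMin ?Dy ?groupJ //.
  by apply: mem_orbit; rewrite memJ_norm // (subsetP nNG).
move=> Ga; apply/eqP; rewrite eqEsubset sub //=.
have Dy := subsetP sGD; have ayK y : to (to y a) a^-1 = y.
  by rewrite actKin ?Dy.
apply/subsetP=> z xa_z; have Va := groupVr Ga.
have /= := subsetP (sub (to x a) _ Va) (to z a^-1) (imset_f _ xa_z).
rewrite ayK => xz; apply/imsetP; exists (to z a^-1) => //.
by rewrite actKVin ?Dy.
Qed.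

Lemma card_orbit_norm x a : a \in G -> #|orbit to N (to x a)| = #|orbit to N x|.
Proof. by move=> Ga; rewrite -setact_orbit_norm // card_setact. Qed.

End NormalOrbits.

(** Induction on [#|S|]. If [G] is transitive, the last derived subgroup [N] acting nontrivially
    acts as an abelian group. Either its orbits are proper blocks, and induction applies to the set
    of blocks and to each block, or [N / K] is regular of order [#|S|], and [der_cent_log] applies
    to it. *)
Theorem sol_perm_der (aT : finGroupType) (D : {group aT}) (T : finType)
    (to : action D T) (G : {group aT}) (S : {set T}) :
  G \subset D -> solvable G -> [acts G, on S | to] ->
  G^`(3 * #|S|.-1) \subset 'C(S | to).
Proof.
have [m] := ubnP #|S|; elim: m => // m IHm in aT D T to G S *.
rewrite ltnS => leSm sGD solG actG.
have Dy := subsetP sGD; have sdG n := subset_trans (der_sub n G) sGD.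
suff fixG x : x \in S -> G^`(3 * #|S|.-1) \subset 'C[x | to].
  apply/subsetP=> g Gg; apply/setIP; split; first exact: (subsetP (sdG _) _ Gg).
  rewrite inE; apply/subsetP=> x Sx; rewrite inE.
  by rewrite (astab_act (subsetP (fixG x Sx) g Gg)) ?set11.
move=> Sx; pose O := orbit to G x.
have sOS : O \subset S by rewrite acts_sub_orbit.
have O0 : 0 < #|O| by rewrite (cardD1 x) orbit_refl.
have [ltOS | leSO] := ltnP #|O| #|S|.
  have actO : [acts G, on O | to] by apply: acts_orbit.
  have sOx : 'C(O | to) \subset 'C[x | to].
    by apply: astabS; rewrite sub1set orbit_refl.
  apply: subset_trans sOx; have ltOm := leq_trans ltOS leSm.
  apply: subset_trans (IHm _ _ _ to G O ltOm sGD solG actO); apply: der_subn.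
  by rewrite leq_mul2l -!subn1 leq_sub2r // ltnW.
have defO : O = S by apply/eqP; rewrite eqEcard sOS.
have transN (N : {group aT}) : G \subset 'N(N) -> N \subset G ->
    forall y, y \in S -> #|orbit to N y| = #|orbit to N x|.
  move=> nNG sNG y; rewrite -defO => /orbitP[g Gg <-].
  by rewrite (card_orbit_norm to sGD nNG sNG x Gg).
pose K := 'C_G(S | to)%G.
have nsKG : K <| G.
  rewrite /normal subsetIl normsI ?normG //.
  exact: subset_trans actG (astab_norm to S).
have sKC : K \subset 'C(S | to) by apply: subsetIr.
have nKG := normal_norm nsKG.
suff sGK : G^`(3 * #|S|.-1) \subset K.
  by apply: subset_trans (subset_trans sGK sKC) _; apply: astabS; rewrite sub1set.
have exj : exists n, G^`(n) \subset K.
  by have /derivedP[n Gn1] := solG; exists n; rewrite Gn1 sub1G.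
case: (ex_minnP exj) => [[|j] sGjK minj].
  exact: subset_trans (der_sub _ _) sGjK.
pose N := [group of G^`(j)].
have sNG : N \subset G := der_sub j G.
have nNG : G \subset 'N(N) := der_norm j G.
have notNK : ~~ (N \subset K) by apply/negP=> /minj; rewrite ltnn.
have nKN : N \subset 'N(K) := subset_trans sNG nKG.
have abN : abelian (N / K).
  by rewrite sub_der1_abelian // (_ : N^`(1) = G^`(j.+1)).
have [y Sy s2] : exists2 y, y \in S & 1 < #|orbit to N y|.
  apply/exists_inP; apply: contraR notNK; rewrite negb_exists_in => /forall_inP sml.
  rewrite subsetI sNG; apply/subsetP=> g Ng; apply/setIP; split; first by rewrite Dy ?(subsetP sNG).
  rewrite inE; apply/subsetP=> z Sz; rewrite inE; apply/eqP.
  have := sml z Sz; rewrite -leqNgt => /card_le1_eqP eqz; apply: eqz.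
    exact: orbit_refl.
  exact: mem_orbit.
rewrite (transN N) // in s2.
pose P := orbit to N @: S.
have actN : [acts N, on S | to] := subset_trans sNG actG.
have partP : partition P S by apply: orbit_partition.
have cardS : #|S| = #|P| * #|orbit to N x|.
  apply: card_uniform_partition partP => _ /imsetP[z Sz ->]; exact: transN.
have Px : orbit to N x \in P by apply: imset_f.
have P0 : 0 < #|P| by rewrite (cardD1 (orbit to N x)) Px.
have [P1 | P2] := leqP #|P| 1; last first.
  have actP : [acts G, on P | to^*].
    apply/subsetP=> g Gg; apply/setIP; split; first exact: Dy.
    rewrite inE; apply/subsetP=> _ /imsetP[z Sz ->].
    by rewrite inE (setact_orbit_norm to sGD) // imset_f // (acts_act actG).
  have {}ltP : #|P| < m by apply: leq_trans leSm; rewrite cardS ltn_Pmulr.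
  have lts : #|orbit to N x| < m.
    by apply: leq_trans leSm; rewrite cardS ltn_Pmull // ltnW.
  have sHP := IHm _ _ _ _ G P ltP sGD solG actP.
  set H := G^`(_) in sHP.
  have sHG : H \subset G by apply: der_sub.
  apply: subset_trans (der_subn _ _) _; last first.
    apply: (@der_comp_sub _ G [group of H] K _ (3 * #|orbit to N x|.-1) (subxx _)).
    rewrite subsetI (subset_trans (der_sub _ _)) //=.
    apply/subsetP=> h Hh; apply/setIP; split.
      by apply/Dy/(subsetP sHG); apply: (subsetP (der_sub _ _)) Hh.
    rewrite inE; apply/subsetP=> z Sz; rewrite inE.
    have actHz : [acts [group of H], on orbit to N z | to].
      apply/subsetP=> b Hb; have Db := Dy _ (subsetP sHG b Hb); apply/setIP; split=> //.
      have Pz : orbit to N z \in P by apply: imset_f.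
      have fixb := astab_act (subsetP sHP b Hb) Pz.
      rewrite inE; apply/subsetP=> t tz; rewrite inE -fixb; exact: imset_f.
    have ltz : #|orbit to N z| < m by rewrite (transN N).
    have sHD := subset_trans sHG sGD; have solH := solvableS sHG solG.
    have := IHm _ _ _ to [group of H] _ ltz sHD solH actHz.
    rewrite (transN N) // => /subsetP/(_ h Hh) cz.
    by rewrite (astab_act cz) ?orbit_refl.
  rewrite cardS -mulnDr leq_mul2l /=; move: P2 s2.
  case: #|P| => // a _; case: #|orbit to N x| => // b _.
  by rewrite mulSn mulnS /= addnCA addnA leq_addr.
have {P1 P0} P1 : #|P| = 1 by apply/eqP; rewrite eqn_leq P1.
rewrite P1 mul1n in cardS.
have defS : orbit to N x = S.
  by apply/eqP; rewrite eqEcard -cardS leqnn acts_sub_orbit // Sx.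
(* As [N] is transitive on [S], an element that centralizes [N / K] and fixes one point fixes all of
   them; hence [N / K] is regular and contains its own centralizer in [G / K]. *)
have fixK u : u \in G -> coset K u \in 'C(N / K) -> to x u = x -> u \in K.
  move=> Gu cNu fixu; have Du := Dy u Gu.
  apply/setIP; split=> //; apply/setIP; split; first exact: Dy.
  rewrite inE; apply/subsetP=> z Sz; rewrite inE; move: (Sz).
  rewrite -defS => /orbitP[b Nb def_z].
  have Gb := subsetP sNG b Nb.
  have Kbu : [~ b, u] \in K.
    have [nKb nKu] := (subsetP nKG b Gb, subsetP nKG u Gu).
    apply: coset_idr; first by rewrite groupR.
    rewrite morphR //; apply/eqP/commgP/commute_sym.
    by apply: (centP cNu); apply: mem_quotient.
  have Dbu : [~ b, u] \in D by rewrite Dy ?groupR.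
  have Db := Dy b Gb; rewrite -{1}def_z -actMin // [(b * u)%g]commgC.
  rewrite (actMin to x (groupM Du Db) Dbu) actMin //.
  by rewrite fixu def_z (astab_act (subsetP sKC _ Kbu)).
have sND := subset_trans sNG sGD.
have stabN : 'C_N[x | to] = N :&: K.
  apply/eqP; rewrite eqEsubset; apply/andP; split.
    apply/subsetP=> n /setIP[Nn cxn]; have Gn := subsetP sNG n Nn.
    rewrite inE Nn fixK // ?(astab_act cxn) ?set11 //.
    by apply: (subsetP abN); apply: mem_quotient.
  by rewrite setIS // (subset_trans sKC) // astabS // sub1set.
have cardN : #|N / K| = #|S|.
  by rewrite card_quotient // -indexgI -stabN -(card_orbit_in to x sND) cardS.
pose l := trunc_log 2 #|S|; pose H := [group of G^`(l * l.+1)].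
have sHG : H \subset G by apply: der_sub.
have nKH := subset_trans sHG nKG.
have cHN : H / K \subset 'C(N / K).
  rewrite quotient_der // /l -cardN; apply: der_cent_log; first exact: quotient_sol.
  exact: quotient_norms.
have sHKN : H \subset (K * N)%g.
  apply/subsetP=> h Hh; have Gh := subsetP sHG h Hh.
  have: to x h \in S by rewrite (acts_act actG).
  rewrite -defS => /orbitP[n Nn def_n]; have Gn := subsetP sNG n Nn.
  rewrite -(mulgKV n h) mem_mulg //; apply: fixK; first by rewrite groupM ?groupV.
    rewrite morphM ?groupV ?(subsetP nKG) // groupM //.
      by apply: (subsetP cHN); apply: mem_quotient.
    rewrite morphV ?(subsetP nKG) // groupV.
    by apply: (subsetP abN); apply: mem_quotient.
  by rewrite actMin ?groupV ?Dy // -def_n actKin ?Dy.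
have sH'K : H^`(1) \subset K.
  apply: (der1_min nKH); apply: (abelianS _ abN).
  by rewrite -(quotientMidl K N) quotientS.
apply: subset_trans (der_subn _ _) (der_comp_sub (subxx _) sH'K).
by apply: quadratic_log_bound; rewrite cardS.
Qed.

(** * Orbits of irreducible linear groups *)

(** On [A] the map [f] factors through [h]. Numbers of orbits are compared in this way. *)
Lemma leq_card_imset_factor (aT rT1 rT2 : finType) (A : {set aT})
    (f : aT -> rT1) (h : aT -> rT2) :
  {in A &, forall x y, h x = h y -> f x = f y} -> #|f @: A| <= #|h @: A|.
Proof.
move=> fh; have [-> | [x0 Ax0]] := set_0Vmem A; first by rewrite imset0 cards0.
pose g z := f (odflt x0 [pick x in A | h x == z]).
suff: f @: A \subset g @: (h @: A).
  by move=> sub; apply: leq_trans (subset_leq_card sub) (leq_imset_card _ _).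
apply/subsetP=> _ /imsetP[x Ax ->]; apply/imsetP; exists (h x); first exact: imset_f.
rewrite /g; case: pickP => [y /andP[Ay /eqP hy] | /(_ x)]; last by rewrite Ax eqxx.
exact: fh.
Qed.

Section Orbits.

Local Open Scope ring_scope.
Local Open Scope nat_scope.

Variables (F : finFieldType) (gT : finGroupType) (G : {group gT}) (n : nat).
Variable rG : mx_representation F G n.

Definition repr_orbit (v : 'rV[F]_n) : {set 'rV[F]_n} := [set v *m rG g | g in G].

(** The orbit of the zero vector is counted too. *)
Definition repr_orbits := [set repr_orbit v | v in [set: 'rV[F]_n]].

Lemma repr_orbit_id v : v \in repr_orbit v.
Proof. by apply/imsetP; exists 1%g; rewrite ?repr_mx1 ?mulmx1. Qed.

Lemma repr_orbit_eqP u v :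
  reflect (exists2 g, g \in G & v = u *m rG g) (repr_orbit u == repr_orbit v).
Proof.
apply: (iffP eqP) => [eq_uv | [g Gg ->]].
  by have := repr_orbit_id v; rewrite -eq_uv => /imsetP.
apply/setP=> w; apply/imsetP/imsetP=> -[h Gh ->].
  exists (g^-1 * h)%g; first by rewrite groupM ?groupV.
  by rewrite -mulmxA -repr_mxM ?mulKVg // groupM ?groupV.
by exists (g * h)%g; rewrite ?groupM // -mulmxA -repr_mxM.
Qed.

Lemma repr_orbits_gt0 : 0 < #|repr_orbits|.
Proof. by rewrite (cardD1 (repr_orbit 0)) imset_f ?inE. Qed.

Lemma card_rV_orbits : #|{: 'rV[F]_n}| <= #|repr_orbits| * #|G|.
Proof.
have sub : [set: 'rV[F]_n] \subset cover repr_orbits.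
  apply/subsetP=> v _; apply/bigcupP; exists (repr_orbit v); last exact: repr_orbit_id.
  by rewrite imset_f.
rewrite -cardsT; apply: leq_trans (subset_leq_card sub) _.
apply: leq_trans (leq_card_cover _) _; rewrite -sum_nat_const leq_sum // => X.
by case/imsetP=> v _ ->; apply: leq_imset_card.
Qed.

End Orbits.

(** * Orbits and homogeneous components *)

Section Imprimitive.

Local Open Scope ring_scope.
Local Open Scope nat_scope.

Variables (F : finFieldType) (gT : finGroupType) (G H : {group gT}).
Hypothesis nsHG : H <| G.
Variables (n : nat) (rG : mx_representation F G n).
Hypothesis irrG : mx_irreducible rG.
Variable sH : socleType (subg_repr rG (normal_sub nsHG)).

Let V (I : {set sH}) : 'M[F]_n := (\sum_(W in I) W)%MS.

(** The support of [v] is the set of homogeneous components in which [v] has a nonzero part; stating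
    the bound on its size through sums of components avoids projections. *)
Definition short_support (j : nat) (v : 'rV[F]_n) :=
  [exists I : {set sH}, (#|I| <= j) && (v <= V I)%MS].

Lemma short_supportJ j v g : g \in G ->
  short_support j v -> short_support j (v *m rG g).
Proof.
move=> Gg /existsP[I /andP[leI vI]]; pose act := Clifford_action sH.
apply/existsP; exists (act^~ g @: I)%act.
rewrite (leq_trans (leq_imset_card _ _)) //=.
apply: submx_trans (submxMr _ vI) _; rewrite sumsmxMr.
apply/sumsmx_subP=> W IW; apply: (sumsmx_sup (act W g)%act); first exact: imset_f.
by rewrite val_Clifford_act.
Qed.

Lemma short_supportW i j v : i <= j -> short_support i v -> short_support j v.
Proof.
move=> leij /existsP[I /andP[leI vI]].
by apply/existsP; exists I; rewrite (leq_trans leI).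
Qed.

(** The witness is a sum of nonzero vectors from [j.+1] components; as the components are
    independent, no [j] of them can contain it. *)
Lemma ex_long_support j : j < #|sH| ->
  exists2 v, short_support j.+1 v & ~~ short_support j v.
Proof.
move=> ltj.
pose I0 : {set sH} := [set W in take j.+1 (enum sH)].
have cardI0 : #|I0| = j.+1.
  rewrite cardsE (card_uniqP _) ?take_uniq ?enum_uniq // size_takel //.
  by rewrite -cardE.
pose v := (\sum_(W in I0) nz_row W)%R.
have V_nz W (I : {set sH}) : W \in I -> (nz_row W <= V I)%MS.
  by move=> IW; apply: (sumsmx_sup W) => //; apply: nz_row_sub.
have Vv : (v <= V I0)%MS by apply: summx_sub => W; apply: V_nz.
exists v; first by apply/existsP; exists I0; rewrite cardI0 leqnn.
apply/existsP=> -[I /andP[leI vI]].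
have /subsetPn[W I0W notIW] : ~~ (I0 \subset I).
  by apply/negP=> /subset_leq_card; rewrite cardI0 leqNgt ltnS leI.
have /mxdirect_sumsP/(_ W isT) dxW := Socle_direct sH.
have: nz_row W != 0%R by rewrite nz_row_eq0 nz_socle.
rewrite -submx0 -dxW sub_capmx nz_row_sub /=.
have -> : nz_row W = (v - \sum_(W' in I0 | W' != W) nz_row W')%R.
  by rewrite /v (bigD1 W) //= addrK.
case/negP; apply: addmx_sub.
  apply: submx_trans vI _; apply/sumsmx_subP=> W' IW'.
  by rewrite (sumsmx_sup W') //; apply: contraNneq notIW => <-.
rewrite eqmx_opp; apply: summx_sub => W' /andP[_ neqW]; rewrite (sumsmx_sup W') ?nz_row_sub //.
Qed.

Variable W1 : sH.
Let N1 := rstabs rG W1.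
Hypothesis modW1 : mxmodule (subg_repr rG (rstabs_sub rG W1)) W1.
Let rW1 := submod_repr modW1.

(* The orbits meeting [W1] consist of vectors of support size at most 1; each
   support size between 2 and [#|sH|] accounts for at least one more orbit. *)
Lemma orbits_component : #|repr_orbits rW1| + #|sH|.-1 <= #|repr_orbits rG|.
Proof.
pose val := val_submod (U := W1) (m := 1).
pose A := [set repr_orbit rG (val u) | u in [set: 'rV[F]_(\rank W1)]].
have leA : #|repr_orbits rW1| <= #|A|.
  apply: leq_card_imset_factor => u u' _ _ /eqP/repr_orbit_eqP[g Gg eq_u'].
  apply/eqP/repr_orbit_eqP.
  have [u0 | nz_u] := eqVneq u 0%R.
    exists 1%g; first exact: group1.
    rewrite repr_mx1 mulmx1 u0; apply/eqP; rewrite -(val_submod_eq0 (U := W1)).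
    by rewrite -/val eq_u' u0 /val linear0 mul0mx.
  (* A nonzero vector lies in at most one component, so an element taking a nonzero vector of [W1]
     into [W1] stabilizes [W1]. *)
  suff N1g : g \in N1.
    by exists g => //; apply: (@val_submod_inj _ _ W1); rewrite val_submodJ.
  rewrite /N1 -Clifford_astab1; apply/setIP; split=> //.
  rewrite inE sub1set inE; apply/eqP.
  set W2 := (_ W1 g)%act; apply/eqP/idPn=> neW.
  have simW (W : sH) := socle_simple W.
  have dx := component_mx_disjoint (simW _) (simW _) neW.
  have: (val u' <= W2 :&: W1)%MS.
    rewrite sub_capmx val_submodP andbT eq_u' val_Clifford_act //.
    by rewrite submxMr ?val_submodP.
  rewrite dx submx0 eq_u' => /eqP vg0; case/eqP: nz_u; apply/eqP.
  rewrite -(val_submod_eq0 (U := W1)) -/val -(repr_mxK rG Gg (val u)) vg0.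
  by rewrite mul0mx.
have ltS (j : 'I_#|sH|.-1) : j.+1 < #|sH| by rewrite -ltn_predRL.
(* The vector [v_ j] has support size exactly [j.+2], so the sizes from 2 to [#|sH|] all occur. *)
have /fin_all_exists[v_ v_P] : forall j : 'I_#|sH|.-1,
    exists v, short_support j.+2 v && ~~ short_support j.+1 v.
  by move=> j; have [v sv lv] := ex_long_support (ltS j); exists v; rewrite sv.
pose B := [set repr_orbit rG (v_ j) | j : 'I_#|sH|.-1].
have injB i j : repr_orbit rG (v_ i) = repr_orbit rG (v_ j) -> i <= j.
  move=> eq_ij; rewrite leqNgt; apply/negP=> ltji; have /andP[_ /negP[]] := v_P i.
  have /eqP/repr_orbit_eqP[g Gg ->] := esym eq_ij; apply: short_supportJ => //.
  by apply: short_supportW (ltji : j.+2 <= i.+1) _; have /andP[] := v_P j.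
have cardB : #|B| = #|sH|.-1.
  rewrite card_in_imset ?cardsT ?card_ord // => i j _ _ eq_ij.
  by apply/val_inj/eqP; rewrite eqn_leq !injB.
have dAB : A :&: B = set0.
  apply/setP=> X; rewrite !inE; apply/negP=> /andP[/imsetP[u _ ->]] /imsetP[j _].
  move/eqP/repr_orbit_eqP=> [g Gg eq_v]; have /andP[_ /negP[]] := v_P j.
  rewrite eq_v; apply: short_supportJ => //; apply: (@short_supportW 1) => //.
  apply/existsP; exists [set W1]; rewrite cards1 /= (sumsmx_sup W1) ?set11 //.
  exact: val_submodP.
rewrite -cardB; apply: leq_trans (leq_add leA (leqnn _)) _.
rewrite -cardsUI dAB cards0 addn0 subset_leq_card // subUset.
by apply/andP; split; apply/subsetP=> _ /imsetP[u _ ->]; apply: imset_f.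
Qed.

End Imprimitive.

(** With [k] components, [3 * k.-1] steps fix every component. Each component has at least [k.-1]
    orbits fewer than the whole space, and since [3 <= C] this saving pays for those first steps. *)
Lemma imprimitive_repr_der (F : finFieldType) (gT : finGroupType) (G H : {group gT})
    (nsHG : H <| G) n (rG : mx_representation F G n)
    (sH : socleType (subg_repr rG (normal_sub nsHG))) C :
  solvable G -> mx_irreducible rG -> 3 <= C ->
  (forall (W : sH) (modW : mxmodule (subg_repr rG (rstabs_sub rG W)) W),
     let rW := submod_repr modW in
     (rstabs_group rG W)^`(C * #|repr_orbits rW|) \subset rker rW) ->
  G^`(C * #|repr_orbits rG|) \subset rker rG.
Proof.
move=> solG irrG C3 derW; pose act := Clifford_action sH.
pose k := #|sH|; pose P := [group of G^`(3 * k.-1)].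
have sPG : P \subset G := der_sub _ _.
have sPC : P \subset 'C([set: sH] | act).
  have := @sol_perm_der _ G _ act G [set: sH] (subxx _) solG; rewrite cardsT; apply.
  by apply/subsetP=> g Gg; apply/setIP; split=> //; rewrite inE; apply/subsetP=> W _; rewrite !inE.
have sPW (W : sH) : P \subset rstabs rG W.
  rewrite -Clifford_astab1; apply: subset_trans sPC _.
  by apply: astabS; rewrite subsetT.
pose m := C * (#|repr_orbits rG| - k.-1).
have fixW (W : sH) g : g \in P^`(m) -> (W *m rG g = W)%R.
  move=> Pg; have [modW _ _] := Clifford_rstabs_simple irrG W.
  have leO := orbits_component modW.
  have : g \in rker (submod_repr modW).
    apply: (subsetP (derW W modW)); apply: subsetP (dergS _ (sPW W)) _ _.
    apply: subsetP Pg; apply: der_subn; rewrite leq_mul2l.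
    by apply/orP; right; rewrite leq_subRL ?(leq_trans _ leO) ?leq_addl // addnC.
  rewrite rker_submod => /rstab_act; apply.
  exact: submx_refl.
have lekO : k.-1 <= #|repr_orbits rG|.
  have [k0 | /card_gt0P[W _]] := posnP k; first by rewrite k0.
  have [modW _ _] := Clifford_rstabs_simple irrG W.
  exact: leq_trans (leq_addl _ _) (orbits_component modW).
have fix1 : P^`(m) \subset rker rG.
  apply/subsetP=> g Pg; have Gg : g \in G.
    by apply: (subsetP sPG); apply: subsetP Pg; apply: der_sub.
  rewrite inE Gg /= mul1mx; apply/eqP.
  have: ((1%:M)%R <= rfix_mx rG [set g])%MS.
    rewrite -(Clifford_Socle1 irrG sH); apply/sumsmx_subP=> W _.
    by apply/rfix_mxP=> _ /set1P->; apply: fixW.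
  by move/rfix_mxP/(_ g (set11 g)); rewrite mul1mx.
apply: subset_trans (der_subn _ _) (der_comp_sub (subxx _) fix1).
rewrite /m -{2}(subnKC lekO) mulnDr leq_add2r leq_mul2r C3 orbT //.
Qed.

(** * The homogeneous case: the field spanned by an abelian normal subgroup *)

Section Homogeneous.

Local Open Scope ring_scope.
Local Open Scope nat_scope.

Variables (F : finFieldType) (gT : finGroupType) (G A : {group gT}).
Hypothesis nsAG : A <| G.
Variables (n : nat) (rG : mx_representation F G n).
Hypotheses (irrG : mx_irreducible rG) (ffulG : mx_faithful rG).
Let sAG := normal_sub nsAG.
Let rA := subg_repr rG sAG.
Variable sA : socleType rA.
Hypothesis homA : #|sA| <= 1.
Hypothesis abA : abelian A.

Let E := enveloping_algebra_mx rA.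
Let Eset := [set X : 'M[F]_n | (X \in E)%MS].

Lemma homogeneous_component : exists2 W : sA, (W :=: 1%:M)%MS & forall W' : sA, W' = W.
Proof.
have /imsetP[W _ _] := Clifford_atrans irrG sA.
have allW (W' : sA) : W' = W by apply: (fintype_le1P homA).
exists W => //; rewrite -(Clifford_Socle1 irrG sA).
apply: eqmx_sym; apply/eqmxP/andP; split.
  by apply/sumsmx_subP=> W' _; rewrite (allW W').
by rewrite (sumsmx_sup W).
Qed.

Lemma envelop_cent c X : c \in 'C_G(A) -> (X \in E)%MS -> (rG c *m X = X *m rG c)%R.
Proof.
case/setIP=> Gc cAc /envelop_mxP[a ->]; rewrite mulmx_sumr mulmx_suml.
apply: eq_bigr => x Ax; have Gx := subsetP sAG x Ax.
rewrite -scalemxAr -scalemxAl; congr (_ *: _)%R.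
by rewrite /= -!repr_mxM // (centP cAc x Ax).
Qed.

(** If the kernel of [X] is nonzero, it contains a simple [A]-submodule. By homogeneity all simple
    submodules are isomorphic to this one, and the isomorphisms commute with [X], so [X] kills the
    whole space. Thus [E] is a field. *)
Lemma envelop_nz_free X : (X \in E)%MS -> X != 0%R -> row_free X.
Proof.
move=> EX; apply: contraR => nfX.
have modK : mxmodule rA (kermx X).
  apply/kermx_centg_module/centgmxP=> x Ax; rewrite -envelop_cent //.
  by rewrite inE (subsetP sAG) // (subsetP abA).
have nzK : kermx X != 0%R by rewrite kermx_eq0.
apply: (mxsimple_exists modK nzK) => -[S simS sSK].
have [W W1 _] := homogeneous_component.
have isoS U : mxsimple rA U -> mx_iso rA S U.
  have isoW U' : mxsimple rA U' -> mx_iso rA (socle_base W) U'.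
    by move=> simU'; apply: component_mx_iso => //; [exact: socle_simple | rewrite W1 submx1].
  move=> simU; apply: mx_iso_trans (isoW U simU); apply: mx_iso_sym; exact: isoW.
rewrite -submx0 -[X]mul1mx.
have [I [U isoU def1]] := component_mx_def (socle_simple W).
apply: submx_trans (submxMr X _) _.
  by rewrite -W1.
rewrite /socle_val def1 sumsmxMr; apply/sumsmx_subP=> i _.
have simU := mx_iso_simple (isoU i) (socle_simple W).
have [f uf homf defU] := isoS _ simU.
rewrite -(eqmxMr X defU) -(hom_envelop_mxC homf EX).
by move/sub_kermxP: sSK => ->; rewrite mul0mx.
Qed.

Lemma envelop_mul_eq0 X Y : (X \in E)%MS -> (Y \in E)%MS ->
  (X *m Y == 0)%R = (X == 0%R) || (Y == 0%R).
Proof.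
move=> EX EY; have [->|nzX] := eqVneq X 0%R; first by rewrite mul0mx eqxx.
have [->|nzY] := eqVneq Y 0%R; first by rewrite mulmx0 eqxx.
by rewrite mulmx_free_eq0 ?(negPf nzX) // envelop_nz_free.
Qed.

(** Applying the elements of [E] to a fixed nonzero vector of [M] is injective because nonzero
    elements of [E] are invertible, and onto [M] because [M] is simple. *)
Lemma card_envelop M : mxsimple rA M -> #|Eset| = #|F| ^ \rank M.
Proof.
move=> simM; have [modM nzM minM] := simM.
pose v := nz_row M; have nzv : v != 0%R by rewrite nz_row_eq0.
have sMv : (cyclic_mx rA v :=: M)%MS.
  have sub : (cyclic_mx rA v <= M)%MS by rewrite cyclic_mx_sub ?nz_row_sub.
  by apply/eqmxP; rewrite sub minM ?cyclic_mx_module ?cyclic_mx_eq0.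
rewrite -card_rowg -(_ : [set v *m X | X in Eset]%R = rowg M).
  rewrite card_in_imset // => X Y; rewrite !inE => EX EY /eqP.
  rewrite -subr_eq0 -mulmxBr => eq0; apply/eqP; rewrite -subr_eq0.
  apply: contraTT eq0 => nzXY; rewrite mulmx_free_eq0 // envelop_nz_free //.
  by rewrite linearB addmx_sub ?eqmx_opp ?Ea.
apply/setP=> u; rewrite inE -sMv; apply/imsetP/cyclic_mxP => -[X EX ->].
  by exists X; rewrite ?inE in EX *.
by exists X; rewrite ?inE.
Qed.

Lemma card_envelop_gt1 : 1 < #|Eset|.
Proof.
have [W _ _] := homogeneous_component.
have simM := socle_simple W; rewrite (card_envelop simM).
case: simM => _ nzM _; apply: leq_trans (card_finNzRing_gt1 F) _.
by rewrite -{1}[#|F|]expn1 leq_pexp2l ?(ltnW (card_finNzRing_gt1 F)) // lt0n mxrank_eq0.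
Qed.

Lemma card_homogeneous_normal : #|A| <= #|Eset|.
Proof.
rewrite -(card_in_imset (f := rG) (D := A)); last first.
  by move=> x y /(subsetP sAG) Gx /(subsetP sAG) Gy; apply: mx_faithful_inj.
by rewrite subset_leq_card //; apply/subsetP=> _ /imsetP[x Ax ->]; rewrite inE (envelop_mx_id rA).
Qed.

(** For [x] in [A] the matrix [rG x - 1] lies in the field [E], so it vanishes as soon as it kills a
    simple submodule. Hence [A] acts faithfully and irreducibly on that submodule. *)
Lemma homogeneous_cyclic : cyclic A.
Proof.
have [W _ _] := homogeneous_component.
have simM := socle_simple W; have [modM nzM _] := simM.
apply: (@mx_faithful_irr_abelian_cyclic _ _ _ _ (submod_repr modM)) => //; last first.
  by apply/submod_mx_irr.
rewrite /mx_faithful rker_submod; apply/subsetP=> x cx.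
have [Ax _] := setIdP cx; apply: (subsetP ffulG); apply/rkerP.
have Gx := subsetP sAG x Ax; split=> //; apply/eqP; rewrite -subr_eq0.
have: (socle_base W *m (rG x - 1%:M) == 0)%R.
  by rewrite mulmxBr mulmx1 subr_eq0; apply/eqP; apply: (rstab_act cx).
apply: contraTT => nz; rewrite mulmx_free_eq0 // envelop_nz_free //.
by rewrite linearB addmx_sub ?eqmx_opp ?(envelop_mx_id rA) ?envelop_mx1.
Qed.

Section Transversal.

Variables (B : {group gT}) (N : nat) (b : 'I_N -> gT).
Hypotheses (sBC : B \subset 'C_G(A)) (centB : 'Z(B) \subset A).
Hypothesis sB'A : [~: B, B] \subset A.
Hypotheses (Bb : forall i, b i \in B).
Hypothesis b_inj : forall i j, ((b i)^-1 * b j)%g \in A -> i = j.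

(* A shortest relation can be shortened by subtracting a multiple of one of its
   conjugates under [B], as in the independence of characters. *)
Lemma envelop_transversal_free (f : 'I_N -> 'M[F]_n) :
  (forall i, (f i \in E)%MS) -> (\sum_i f i *m rG (b i) = 0)%R ->
  forall i, f i = 0%R.
Proof.
have [m] := ubnP #|[set i | f i != 0%R]|; elim: m f => // m IHm f ltm Ef sumf i.
have [//|nzfi] := eqVneq (f i) 0%R.
have sBG : B \subset G := subset_trans sBC (subsetIl _ _).
have Gb j : b j \in G by rewrite (subsetP sBG).
have [j /andP[nji nzfj] | allj] := pickP [pred j | (j != i) && (f j != 0%R)]; last first.
  case/eqP: nzfi; move: sumf; rewrite (bigD1 i) //= big1 ?addr0 => [fi0 | j nji].
    by rewrite -[f i](repr_mxK rG (Gb i)) fi0 mul0mx.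
  by have := allj j; rewrite /= nji => /negbFE/eqP->; rewrite mul0mx.
have notZ : ((b i)^-1 * b j)%g \notin 'Z(B).
  by apply: contra nji => /(subsetP centB)/b_inj->.
have [x Bx ncx] : exists2 x, x \in B & (((b i)^-1 * b j) ^ x != (b i)^-1 * b j)%g.
  apply/exists_inP; apply: contraR notZ; rewrite negb_exists_in => /forall_inP fixx.
  apply/centerP; split=> [|x Bx]; first by rewrite groupM ?groupV.
  by have := fixx x Bx; rewrite negbK => /eqP/conjg_fixP/commgP.
have Gx := subsetP sBG x Bx.
pose a k := [~ x, (b k)^-1]; have Aa k : a k \in A.
  by apply: (subsetP sB'A); rewrite mem_commg ?groupV.
have Ga k : a k \in G by rewrite (subsetP sAG).
have ab k : (a k * b k = b k ^ x)%g.
  by rewrite /a /commg conjgE invgK -!mulgA mulVg mulg1.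
have Ea k : (rG (a k) \in E)%MS by rewrite (envelop_mx_id rA).
have EaB k : (rG (a k) - rG (a i) \in E)%MS by rewrite linearB addmx_sub ?eqmx_opp ?Ea.
(* These are the coefficients of the relation conjugated by [x] minus [rG (a i)] times the original
   one. The [i]-th vanishes, while the [j]-th does not, because [a j != a i]. *)
pose g k := (f k *m (rG (a k) - rG (a i)))%R.
have Eg k : (g k \in E)%MS by apply: envelop_mxM.
have cfA c k : c \in 'C_G(A) -> (f k *m rG c = rG c *m f k)%R.
  by move=> cAc; rewrite (envelop_cent cAc).
have cAa : a i \in 'C_G(A) by rewrite inE Ga (subsetP abA).
have cAx : (x^-1)%g \in 'C_G(A) by rewrite groupV (subsetP sBC).
have sumg : (\sum_k g k *m rG (b k) = 0)%R.
  transitivity (rG x^-1%g *m (\sum_k f k *m rG (b k)) *m rG x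
                - rG (a i) *m (\sum_k f k *m rG (b k)))%R.
    rewrite !mulmx_sumr mulmx_suml -sumrB; apply: eq_bigr => k _.
    rewrite /g mulmxBr mulmxBl !mulmxA -cfA // -cfA //; congr (_ - _)%R.
    rewrite -!mulmxA; congr (_ *m _)%R; rewrite -!repr_mxM ?groupM ?groupV //.
    by rewrite ab conjgE.
  by rewrite sumf !mulmx0 mul0mx subrr.
have ltg : #|[set k | g k != 0%R]| < m.
  rewrite -ltnS; apply: leq_trans ltm; rewrite ltnS; apply: proper_card.
  apply/properP; split; last first.
    by exists i; rewrite ?inE // /g subrr mulmx0 eqxx.
  by apply/subsetP=> k; rewrite !inE; apply: contraNneq => fk0; rewrite /g fk0 mul0mx.
have /eqP := IHm g ltg Eg sumg j; rewrite /g envelop_mul_eq0 // (negPf nzfj) /=.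
rewrite subr_eq0 => /eqP/(mx_faithful_inj ffulG (Ga j) (Ga i)) eq_a.
case/eqP: ncx; rewrite conjMg conjVg -!ab eq_a invMg -mulgA (mulKg (a i)).
by [].
Qed.

(** The space is a direct sum of [t] simple [A]-modules, generated by the vectors [v j]. Every [S f]
    commutes with [A], so it is determined by its values on these vectors. With the independence of
    the [b i] this embeds the [N]-tuples over [E] into the [t]-tuples of vectors, whence
    [N <= t * t]. *)
Lemma transversal_bound :
  exists2 t, #|{: 'rV[F]_n}| = #|Eset| ^ t & N <= t * t.
Proof.
have [W W1 _] := homogeneous_component.
have simM := socle_simple W; set M := socle_base W in simM.
have [modM nzM minM] := simM.
have [t [x_ /(_ W)[Gx sumM dxM]]] := Clifford_component_basis irrG sA simM.
set x := x_ W in Gx sumM dxM.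
have cardE : #|Eset| = #|F| ^ \rank M by apply: card_envelop.
have rank_n : n = t * \rank M.
  transitivity (\rank W); first by rewrite W1 mxrank1.
  rewrite -sumM (mxdirectP dxM) /=.
  rewrite (eq_bigr (fun=> \rank M)) ?sum_nat_const ?card_ord // => j _.
  by rewrite mxrankMfree // row_free_unit repr_mx_unit.
have cardV : #|{: 'rV[F]_n}| = #|Eset| ^ t.
  by rewrite card_mx mul1n cardE -expnM mulnC -rank_n.
exists t => //; pose v j := (nz_row M *m rG (x j))%R.
have v_gen (Y : 'M[F]_n) : centgmx rA Y -> (forall j, v j *m Y = 0)%R -> Y = 0%R.
  move=> cY vY0; have modK := kermx_centg_module cY.
  suff: (W <= kermx Y)%MS by rewrite W1 => /sub_kermxP; rewrite mul1mx.
  rewrite -sumM; apply/sumsmx_subP=> j _.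
  have [modMj nzMj minMj] := Clifford_simple simM (Gx j).
  have Mv : (v j <= M *m rG (x j))%MS by rewrite submxMr ?nz_row_sub.
  have nzv : v j != 0%R.
    by rewrite mulmx_free_eq0 ?nz_row_eq0 // row_free_unit repr_mx_unit.
  apply: submx_trans (minMj (cyclic_mx rA (v j)) _ _ _) _.
  - exact: cyclic_mx_module.
  - exact: cyclic_mx_sub.
  - by rewrite cyclic_mx_eq0.
  by apply: cyclic_mx_sub => //; apply/sub_kermxP.
pose S (f : {ffun 'I_N -> 'M[F]_n}) := (\sum_i f i *m rG (b i))%R.
pose Phi f := [ffun j => v j *m S f]%R.
have cS f : f \in ffun_on (mem Eset) -> centgmx rA (S f).
  move/ffun_onP=> Ef; apply/centgmxP=> y Ay.
  rewrite mulmx_suml mulmx_sumr; apply: eq_bigr => i _ /=.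
  have Gy := subsetP sAG y Ay; have [Gb cb] := setIP (subsetP sBC _ (Bb i)).
  have cy : y \in 'C_G(A) by rewrite inE Gy (subsetP abA).
  have Efi : (f i \in E)%MS by have := Ef i; rewrite inE.
  rewrite mulmxA (envelop_cent cy Efi) -!mulmxA; congr (_ *m _)%R.
  by rewrite -!repr_mxM // (centP cb y Ay).
have SB f h : S (f - h)%R = (S f - S h)%R.
  by rewrite /S -sumrB; apply: eq_bigr => i _; rewrite !ffunE mulmxBl.
have injPhi : {in ffun_on (mem Eset) &, injective Phi}.
  move=> f h Ef Eh eqfh.
  have Efh : (f - h)%R \in ffun_on (mem Eset).
    apply/ffun_onP=> i; rewrite !ffunE inE linearB addmx_sub ?eqmx_opp //.
      by have /ffun_onP/(_ i) := Ef; rewrite inE.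
    by have /ffun_onP/(_ i) := Eh; rewrite inE.
  apply/eqP; rewrite -subr_eq0; apply/eqP/ffunP=> i; rewrite [RHS]ffunE.
  apply: envelop_transversal_free i => [i|]; first by have /ffun_onP/(_ i) := Efh; rewrite inE.
  apply: v_gen => [|j]; first exact: cS.
  rewrite -/(S _) SB mulmxBr; have /ffunP/(_ j) := eqfh; rewrite !ffunE => ->.
  by rewrite subrr.
have : #|Eset| ^ N <= #|Eset| ^ (t * t).
  rewrite expnM -cardV -{1}(card_ord N) -card_ffun_on -(card_in_image injPhi).
  have <- : #|{ffun 'I_t -> 'rV[F]_n}| = #|{: 'rV[F]_n}| ^ t by rewrite card_ffun card_ord.
  exact: max_card.
by rewrite leq_exp2l // card_envelop_gt1.
Qed.

End Transversal.
End Homogeneous.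

Lemma quadratic_le_exp e : 11 <= e -> 3 * (e.*2.+1 * e.*2.+2 + 3) <= 2 ^ e.
Proof.
move/subnK <-; elim: (e - 11) => [|k IHk].
  by vm_compute.
rewrite addSn expnS; set m := k + 11 in IHk *.
have m11 : 11 <= m by rewrite leq_addl.
apply: leq_trans (_ : 2 * (3 * (m.*2.+1 * m.*2.+2 + 3)) <= _); last by rewrite leq_mul2l.
rewrite -!muln2; clear IHk; nia.
Qed.

(* For [l >= 22] the hypothesis makes [O] larger than the left-hand side; for
   smaller [l] the factor 600 suffices. *)
Lemma quadratic_log_le_orbits N d O (l := trunc_log 2 N) :
  0 < N -> N <= d * d -> 0 < O -> 2 ^ (d - 2) <= O * (N * N) ^ l ->
  l * l.+1 + 3 <= 600 * O.
Proof.
move=> N0 leNd O0 leO; have [lt_l | le_l] := ltnP l 22.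
  (* Here the left-hand side is at most [21 * 22 + 3 = 465]. *)
  have: l * l.+1 <= 21 * 22 by apply: leq_mul.
  by lia.
rewrite leqNgt; apply/negP=> ltO; set u := _ + 3 in ltO.
have ltOu : O < u by apply: leq_ltn_trans ltO; rewrite leq_pmull.
(* From [2 ^ l <= N <= d * d] one gets [2 ^ e <= d]; the threshold 22 ensures [e >= 11], as
   [quadratic_le_exp] requires. *)
pose e := l./2; have le_e : 11 <= e by rewrite -[11]/(22./2) half_leq.
have def_l : l <= e.*2.+1 by rewrite -[l in l <= _]odd_double_half -/e -add1n leq_add2r; case: odd.
have lede : 2 ^ e <= d.
  rewrite -leq_sqr -!mulnn; apply: leq_trans leNd.
  apply: leq_trans (_ : 2 ^ l <= _); last exact: trunc_logP.
  rewrite -expnD leq_exp2l // addnn.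
  by rewrite -[leqRHS]odd_double_half leq_addl.
have leu : 3 * u <= 2 ^ e.
  apply: leq_trans (quadratic_le_exp le_e); rewrite leq_mul2l /= leq_add2r.
  by rewrite leq_mul.
have ltN : N < 2 ^ l.+1 by apply: trunc_log_ltn.
have leN : (N * N) ^ l <= 2 ^ (2 * (l * l.+1)).
  have -> : 2 * (l * l.+1) = (l.+1 + l.+1) * l by lia.
  rewrite expnM leq_exp2r ?expnD ?leq_mul 1?ltnW //.
  exact: leq_trans le_l.
have: 2 ^ (d - 2) < 2 ^ (u + 2 * (l * l.+1)).
  apply: leq_ltn_trans leO _; rewrite expnD.
  apply: leq_ltn_trans (leq_mul (leqnn O) leN) _.
  by rewrite ltn_pmul2r ?expn_gt0 // (ltn_trans ltOu) // ltn_expl.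
rewrite ltn_exp2l //; move: leu lede; rewrite /u; lia.
Qed.

Lemma homogeneous_repr_der (F : finFieldType) (gT : finGroupType) (G A : {group gT})
    (nsAG : A <| G) n (rG : mx_representation F G n)
    (sA : socleType (subg_repr rG (normal_sub nsAG))) :
  solvable G -> mx_irreducible rG -> mx_faithful rG -> abelian A ->
  (forall H : {group gT}, H <| G -> abelian H -> A \subset H -> H \subset A) ->
  #|sA| <= 1 -> G^`(600 * #|repr_orbits rG|) = 1%g.
Proof.
move=> solG irrG ffulG abA maxA homA.
have cycA : cyclic A := homogeneous_cyclic irrG ffulG homA abA.
pose C := 'C_G(A); have sAG := normal_sub nsAG.
pose P (B : {set gT}) := [&& A \subset B, B \subset C, B <| G & [~: B, B] \subset A].
have [B maxgB _] : {B : {group gT} | maxgroup B P & A \subset B}.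
  apply: maxgroup_exists; rewrite /P subxx nsAG subsetI sAG /=.
  by have /commG1P-> := abA; rewrite sub1G andbT.
have [/and4P[sAB sBC nsBG sB'A] maxB'] := maxgroupP maxgB.
have maxB (H : {group gT}) : H <| G -> B \subset H -> H \subset C ->
    [~: H, H] \subset A -> H \subset B.
  move=> nsHG sBH sHC sH'A; rewrite (maxB' H) //.
  by rewrite /P (subset_trans sAB) // sHC nsHG.
pose N := #|B : A|; have N0 : 0 < N by apply: indexg_gt0.
pose b (i : 'I_N) := repr (enum_val i).
have bP i : enum_val i = A :* b i.
  by rewrite /b; have /imsetP[x _ ->] := enum_valP i; rewrite rcosetE rcoset_repr.

have Bb i : b i \in B.
  have : b i \in enum_val i by rewrite bP rcoset_refl.
  have /imsetP[x Bx ->] := enum_valP i.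
  by rewrite rcosetE => /rcosetP[a Aa ->]; rewrite groupM ?(subsetP sAB a Aa).
have b_inj i j : ((b i)^-1 * b j)%g \in A -> i = j.
  move=> Aij; apply: enum_val_inj; rewrite !bP; apply/rcoset_eqP/rcosetP.
  exists ((b i)^-1 * b j)^-1%g; first by rewrite groupV.
  have [_ cAb] := setIP (subsetP sBC _ (Bb i)).
  by rewrite -{2}(mulKVg (b i) (b j)) (centP cAb _ Aij) mulKg.
have sZA : 'Z(B) \subset A := center_sub_abelian maxA sAB sBC nsBG.
have [d cardV leNd] :=
  transversal_bound irrG ffulG homA abA sBC sZA sB'A Bb b_inj.
set e := #|_| in cardV; have e1 : 1 < e := card_envelop_gt1 irrG homA abA.
have leA : #|A| <= e := card_homogeneous_normal nsAG ffulG.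
pose l := trunc_log 2 N; pose O := #|repr_orbits rG|.
have leCA : #|C : A| <= (N * N) ^ l.
  exact: index_cent_class2 solG nsAG cycA maxA _ sAB sBC nsBG sB'A maxB.
have leGC : #|G : C| <= #|A| := index_cent_cyclic nsAG cycA.
have leG : #|G| <= (N * N) ^ l * (e * e).
  rewrite -(Lagrange (subsetIl G 'C(A))) -(Lagrange (_ : A \subset C)); last first.
    by rewrite subsetI sAG.
  rewrite -mulnA mulnCA leq_mul // leq_mul //.
  exact: leq_trans leGC leA.
(* Cancel [e * e] in [e ^ d <= O * #|G|] and use [e >= 2]. When [d <= 2] the truncated difference
   makes the left side 1. *)
have leO : 2 ^ (d - 2) <= O * (N * N) ^ l.
  have NN0 : 0 < (N * N) ^ l by rewrite expn_gt0 muln_gt0 N0.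
  have O0 : 0 < O by apply: repr_orbits_gt0.
  have [led2 | ltd2] := leqP d 2.
    by rewrite (eqP (led2 : d - 2 == 0)) muln_gt0 O0.
  have := leq_trans (card_rV_orbits rG) (leq_mul (leqnn O) leG).
  rewrite cardV -{1}(subnK (ltnW ltd2)) expnD -mulnn [O * (_ * _)]mulnA leq_pmul2r ?muln_gt0 ?(ltnW e1) //.
  by apply: leq_trans; rewrite leq_exp2r // subn_gt0.
have := quadratic_log_le_orbits N0 leNd (repr_orbits_gt0 rG) leO.
move/(der_subn G); rewrite (der_class2 solG nsAG cycA maxA sAB sBC nsBG sB'A maxB).
by move/trivgP.
Qed.

Theorem irr_repr_der (F : finFieldType) (gT : finGroupType) (G : {group gT}) n
    (rG : mx_representation F G n) :
  solvable G -> mx_irreducible rG ->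
  G^`(600 * #|repr_orbits rG|) \subset rker rG.
Proof.
have [m] := ubnP n; elim: m => // m IHm in gT G n rG *.
rewrite ltnS => lenm solG irrG.
wlog ffulG : gT G rG solG irrG / mx_faithful rG.
  move=> IH; have nKG := rker_norm rG.
  have := IH _ _ (kquo_repr rG) (quotient_sol _ solG).
  have irrK : mx_irreducible (kquo_repr rG) by apply/quo_mx_irr.
  move/(_ irrK (kquo_mx_faithful rG)).
  have -> : #|repr_orbits (kquo_repr rG)| = #|repr_orbits rG|.
    congr #|pred_of_set _|; apply: eq_imset => v; apply/setP=> w.
    apply/imsetP/imsetP=> [[_ /morphimP[g Ng Gg ->]] | [g Gg]] ->.
      by exists g => //; rewrite kquo_repr_coset.
    by exists (coset (rker rG) g); rewrite ?mem_quotient ?kquo_repr_coset.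
  rewrite -quotient_der // => sub; rewrite -quotient_sub1 ?(subset_trans (der_sub _ _)) //.
  apply: subset_trans sub _; apply/trivgP; apply/trivgP; exact: kquo_mx_faithful.
pose P (A : {set gT}) := (A <| G) && abelian A.
have [A maxgA _] : {A : {group gT} | maxgroup A P & [1 gT]%G \subset A}.
  by apply: maxgroup_exists; rewrite /P normal1 abelian1.
have [/andP[nsAG abA] maxA'] := maxgroupP maxgA.
have maxA (H : {group gT}) : H <| G -> abelian H -> A \subset H -> H \subset A.
  by move=> nsHG abH sAH; rewrite (maxA' H) // /P nsHG.
apply: (socle_exists (subg_repr rG (normal_sub nsAG))) => sA.
have [homA | ltA] := leqP #|sA| 1.
  by rewrite (homogeneous_repr_der solG irrG ffulG abA maxA homA) sub1G.
apply: (imprimitive_repr_der (sH := sA)) => //= W modW.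
apply: IHm; last 2 first.
- exact: solvableS (rstabs_sub _ _) solG.
- by apply/submod_mx_irr; apply: Clifford_rstabs_simple.
(* The components have equal dimension and there are at least two of them, so the dimension
   drops. *)
apply: leq_trans lenm; apply: leq_trans (eq_leq (Clifford_rank_components irrG W)).
by rewrite ltn_Pmull // lt0n mxrank_eq0 nz_socle.
Qed.

(** [V] is an irreducible module for [G]. By Brauer's permutation lemma each element of [G] fixes as
    many irreducible characters as classes of [V], so by the Cauchy-Frobenius formula [G] has
    equally many orbits on both; the classes are single elements. *)
Lemma minnormal_der (gT : finGroupType) (G V : {group gT}) :
  solvable G -> V \subset G -> minnormal V G ->
  G^`(600 * #|cfclass_Iirr G @: [set: Iirr V]|) \subset 'C(V).
Proof.
move=> solG sVG minV; have [nVG ntV abelV] := minnormal_solvable minV sVG solG.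
have [p pr_p abelV_p] := is_abelemP abelV.
have abV := abelem_abelian abelV_p.
have nsVG : V <| G by apply/andP.
pose rG := abelem_repr abelV_p ntV nVG.
have irrG : mx_irreducible rG by apply/abelem_mx_irrP.
have := irr_repr_der solG irrG; rewrite rker_abelem => derC.
apply: subset_trans (der_subn _ _) (subset_trans derC (subsetIr _ _)).
rewrite leq_mul2l /=.
have actIirrV : is_action G (@conjg_Iirr _ V).
  split=> [y j k eq_jk | j y z Gy Gz].
    by apply/irr_inj/(can_inj (cfConjgK y)); rewrite -!conjg_IirrE eq_jk.
  by apply: irr_inj; rewrite !conjg_IirrE (cfConjgM _ nsVG).
pose ito := Action actIirrV; pose cto := ('Js \ (subsetT G))%act.
have acts_Js : [acts G, on classes V | 'Js].
  apply/subsetP=> y Gy; have nVy := subsetP nVG y Gy.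
  rewrite !inE; apply/subsetP=> _ /imsetP[z Gz ->] /[!inE]/=.
  rewrite -class_rcoset norm_rlcoset // class_lcoset.
  by apply: imset_f; rewrite memJ_norm.
have acts_cto : [acts G, on classes V | cto] by rewrite astabs_ract subsetIidl.
have acts_ito : [acts G, on [set: Iirr V] | ito].
  by apply/subsetP=> g Gg; apply/setIP; split=> //; rewrite inE; apply/subsetP=> i; rewrite !inE.
have eq_orb : #|orbit ito G @: [set: Iirr V]| = #|orbit cto G @: classes V|.
  apply/eqP; rewrite -(eqn_pmul2r (cardG_gt0 G)) -!Frobenius_Cauchy //.
  apply/eqP/eq_bigr => x Gx; rewrite setTI.
  apply: card_afix_irr_classes => // j y _ Vy /imsetP[_ /imsetP[z Vz ->] ->].
  by rewrite conjg_IirrE cfConjgEJ ?(subsetP nVG) // cfunJ.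
apply: leq_trans (eq_leq (esym eq_orb)).
pose h (v : 'rV_('dim V)) := orbit cto G (rVabelem abelV_p ntV v ^: V).
apply: leq_trans (_ : #|h @: [set: _]| <= _); last first.
  rewrite subset_leq_card //; apply/subsetP=> _ /imsetP[v _ ->].
  by apply/imset_f/imset_f/mem_rVabelem.
apply: leq_card_imset_factor => u v _ _ eq_h; apply/eqP/repr_orbit_eqP.
have cl1 x : x \in V -> x ^: V = [set x] by move=> Vx; apply/abelian_classP.
have : rVabelem abelV_p ntV v ^: V \in h v by apply: orbit_refl.
rewrite -eq_h => /orbitP[g Gg]; rewrite /= !cl1 ?mem_rVabelem // conjg_set1.
move/set1_inj=> eq_v; exists g => //.
by apply: (@rVabelem_inj _ _ _ abelV_p ntV); rewrite rVabelemJ.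
Qed.

Local Open Scope ring_scope.

(** * The constituents of [chi * chi^*] *)

Lemma constt_addl (gT : finGroupType) (G : {group gT}) (phi xi : 'CF(G)) :
  phi \is a character -> xi \is a character ->
  {subset irr_constt phi <= irr_constt (phi + xi)}.
Proof.
move=> Nphi Nxi i; rewrite !irr_consttE cfdotDl; apply: contraNneq => /eqP.
by rewrite paddr_eq0 ?natr_ge0 ?Cnat_cfdot_char_irr // => /andP[].
Qed.

Lemma constt_Res_exists (gT : finGroupType) (G H : {group gT}) (psi : 'CF(G)) j :
  j \in irr_constt ('Res[H] psi) ->
  exists2 i, i \in irr_constt psi & j \in irr_constt ('Res[H] 'chi_i).
Proof.
rewrite irr_consttE => nz_j.
apply/exists_inP; apply: contraR nz_j; rewrite negb_exists_in => /forall_inP z.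
rewrite [psi]cfun_sum_constt linear_sum cfdot_suml big1 // => i psi_i.
have := z i psi_i; rewrite irr_consttE negbK => /eqP zi.
by rewrite linearZ cfdotZl zi mulr0.
Qed.

Lemma constt_mul_exists (gT : finGroupType) (G : {group gT}) (phi xi : 'CF(G)) j :
  j \in irr_constt (phi * xi) ->
  exists2 i, i \in irr_constt phi & j \in irr_constt ('chi_i * xi).
Proof.
rewrite irr_consttE => nz_j.
apply/exists_inP; apply: contraR nz_j; rewrite negb_exists_in => /forall_inP z.
rewrite [phi]cfun_sum_constt mulr_suml cfdot_suml big1 // => i phi_i.
have := z i phi_i; rewrite irr_consttE negbK => /eqP zi.
by rewrite -scalerAl cfdotZl zi mulr0.
Qed.

Lemma cfdot_mul_conj (gT : finGroupType) (G : {group gT}) (a b c : 'CF(G)) :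
  '[a * b^*%CF, c] = '[a, b * c].
Proof.
rewrite !cfdotE; congr (_ * _); apply: eq_bigr => x _.
by rewrite !cfunE rmorphM /= mulrA.
Qed.

Lemma constt_mul_conj_exists (gT : finGroupType) (G : {group gT}) (phi : 'CF(G)) j :
  j \in irr_constt (phi * phi^*%CF) ->
  exists i k, [/\ i \in irr_constt phi, k \in irr_constt phi
                & j \in irr_constt ('chi_i * ('chi_k)^*%CF)].
Proof.
case/constt_mul_exists=> i phi_i; rewrite mulrC.
case/constt_mul_exists=> k phi_k; rewrite mulrC => ij.
exists i, (conjC_Iirr k); rewrite conjC_IirrE cfConjCK; split=> //.
move: phi_k; rewrite !irr_consttE conjC_IirrE -[in X in _ -> X](cfConjCK phi).
by rewrite cfdot_conjC conjC_eq0.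
Qed.

Lemma constt_mul_conj (gT : finGroupType) (G : {group gT}) (phi : 'CF(G)) i k :
  phi \is a character -> i \in irr_constt phi -> k \in irr_constt phi ->
  {subset irr_constt ('chi_i * ('chi_k)^*%CF) <= irr_constt (phi * phi^*%CF)}.
Proof.
move=> Nphi /(constt_charP i Nphi)[xi Nxi def_phi] /(constt_charP k Nphi)[xj Nxj def_phi'].
have Nc (eta : 'CF(G)) : eta \is a character -> eta^*%CF \is a character.
  by rewrite cfConjC_char.
move=> j ikj.
have -> : phi * phi^*%CF = 'chi_i * ('chi_k)^*%CF + ('chi_i * xj^*%CF + xi * phi^*%CF).
  rewrite {1}def_phi mulrDl addrA; congr (_ + _).
  by rewrite def_phi' rmorphD mulrDr.
apply: constt_addl ikj; first by rewrite rpredM ?irr_char ?Nc ?irr_char.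
by rewrite rpredD // rpredM ?irr_char ?Nc.
Qed.

Section Constituents.

Variables (gT : finGroupType) (G : {group gT}) (chi : 'CF(G)).
Hypothesis Nchi : chi \is a character.
Let psi := chi * chi^*%CF.

Let Npsi : psi \is a character.
Proof. by rewrite rpredM ?cfConjC_char. Qed.

(** This is the set [S(L)]; for trivial [L] its size is [eta chi]. *)
Definition constt_over (L : {set gT}) :=
  [set i | (i \in irr_constt psi) && (i != 0) & L \subset cfker 'chi_i].

(* The largest subgroup contained in the kernels of all members of
   [constt_over L]; it is [G] when there are none. *)
Definition constt_ker (L : {set gT}) :=
  (G :&: \bigcap_(i in constt_over L) cfker 'chi_i)%G.

Lemma constt_ker_normal L : constt_ker L <| G.
Proof.
rewrite /normal subsetIl normsI ?normG //=; apply/norms_bigcap/bigcapsP=> i _.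
exact: cfker_norm.
Qed.

Lemma sub_constt_ker (L : {set gT}) : L \subset G -> L \subset constt_ker L.
Proof.
move=> sLG; rewrite subsetI sLG; apply/bigcapsP=> i.
by rewrite inE => /andP[].
Qed.

Lemma constt_ker_sub L i : i \in constt_over L -> constt_ker L \subset cfker 'chi_i.
Proof. by move=> Li; rewrite /= subIset // (bigcap_inf i) ?orbT. Qed.

(** Consequently [constt_ker] is idempotent, and its values satisfy the closedness hypothesis of the
    induction. *)
Lemma constt_over_ker (L : {set gT}) : L \subset G ->
  constt_over (constt_ker L) = constt_over L.
Proof.
move=> sLG; apply/setP=> i; apply/idP/idP=> [|Li].
  rewrite !inE => /andP[->]; exact: subset_trans (sub_constt_ker sLG).
by have := Li; rewrite !inE => /andP[-> _]; apply: constt_ker_sub.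
Qed.

Lemma constt_overS (L E : {set gT}) : L \subset E -> constt_over E \subset constt_over L.
Proof.
move=> sLE; apply/subsetP=> i; rewrite !inE => /andP[-> ]; exact: subset_trans.
Qed.

(* The squared norm of the restriction counts the constituents of
   ['chi_i * 'chi_i^*] trivial on [E]; those are trivial on [D]. *)
Lemma constt_Res_irr (E D : {group gT}) (i : Iirr D) :
  E <| G -> E \subset D -> D \subset constt_ker E ->
  i \in irr_constt ('Res[D] chi) -> 'Res[E] 'chi_i \in irr E.
Proof.
move=> nsEG sED sDK chi_i; have sDG : D \subset G := subset_trans sDK (subsetIl _ _).
rewrite irrEchar cfRes_char ?irr_char //=.
pose xi := 'chi_i * ('chi_i)^*%CF.
(* Such a [j] lies under a constituent [a] of [psi] whose restriction to [E] contains the principal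
   character. By normality [E] lies in the kernel of [a], hence so does [D], and [j] is
   principal. *)
have Res_xi0 j : j \in irr_constt xi -> j != 0 -> '['Res[E] 'chi_j, 1] = 0.
  move=> xi_j nzj; apply/eqP; rewrite -irr0 -[_ == 0]negbK -irr_consttE.
  apply: contra nzj => Ej.
  have NchiD : 'Res[D] chi \is a character by apply: cfRes_char.
  have : j \in irr_constt ('Res[D] psi).
    rewrite rmorphM /= -cfAutRes; exact: (constt_mul_conj NchiD chi_i chi_i).
  case/constt_Res_exists=> a psi_a Dj.
  have Ea : (0 : Iirr E) \in irr_constt ('Res[E] 'chi_a).
    rewrite -(cfResRes _ sED sDG).
    by apply: constt_Res_trans Ej => //; rewrite cfRes_char ?irr_char.
  have kerDa : D \subset cfker 'chi_a.
    have [-> | nza] := eqVneq a 0; first by rewrite cfker_irr0.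
    apply: subset_trans sDK (constt_ker_sub _).
    by rewrite inE psi_a nza constt0_Res_cfker.
  have := cfker_constt (cfRes_char D (irr_char a)) Dj.
  rewrite cfker_Res // ?irr_char // (setIidPl kerDa).
  by rewrite subGcfker.
have <- : '[xi, 1] = 1 :> algC.
  by rewrite /xi cfdot_mul_conj mulr1 cfnorm_irr.
have -> : '['Res[E] 'chi_i] = '['Res[E] xi, 1].
  by rewrite rmorphM /= -cfAutRes cfdot_mul_conj mulr1.
rewrite {1}[xi]cfun_sum_cfdot linear_sum cfdot_suml (bigD1 (0 : Iirr D)) //=.
rewrite linearZ cfdotZl irr0 rmorph1 cfnorm1 mulr1 big1 ?addr0 // => j nzj.
rewrite linearZ cfdotZl; have [xi_j | ] := boolP (j \in irr_constt xi).
  by rewrite Res_xi0 ?mulr0.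
by rewrite irr_consttE negbK => /eqP->; rewrite mul0r.
Qed.

Lemma constt_Res_conj (D : {group gT}) (a : Iirr G) (j : Iirr D) :
  a \in irr_constt psi -> j \in irr_constt ('Res[D] 'chi_a) ->
  exists i k, [/\ i \in irr_constt ('Res[D] chi), k \in irr_constt ('Res[D] chi)
                & j \in irr_constt ('chi_i * ('chi_k)^*%CF)].
Proof.
move=> psi_a a_j; apply: constt_mul_conj_exists.
have := constt_Res_trans Npsi psi_a a_j; rewrite rmorphM /= -cfAutRes.
exact.
Qed.

(* ['chi_j] restricts to a multiple of a linear [lam], and [lam] occurs at most
   once in the product of an irreducible and a conjugate irreducible of [E]. *)
Lemma constt_Res_linear (L E C : {group gT}) a (j : Iirr C) :
  E <| G -> L \subset C -> E \subset C -> C \subset constt_ker E ->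
  [~: E, C] \subset L -> a \in constt_over L -> j \in irr_constt ('Res[C] 'chi_a) ->
  'chi_j \is a linear_char.
Proof.
move=> nsEG sLC sEC sCK sECL aL a_j.
have sCG : C \subset G := subset_trans sCK (subsetIl _ _).
have [psi_a sLa] : a \in irr_constt psi /\ L \subset cfker 'chi_a.
  by move: aL; rewrite inE => /andP[/andP[]].
have sLj : L \subset cfker 'chi_j.
  apply: subset_trans (cfker_constt (cfRes_char C (irr_char a)) a_j).
  by rewrite cfker_Res ?irr_char // subsetI sLC.
(* Since [[E, C]] lies in [L], and so in the kernel of ['chi_j], the group [E] is central modulo
   that kernel. *)
have sEZ : E \subset 'Z('chi_j)%CF.
  have nkC : C \subset 'N(cfker 'chi_j) := cfker_norm _.
  have: (E / cfker 'chi_j \subset 'Z('chi_j)%CF / cfker 'chi_j)%g.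
    rewrite cfcenter_eq_center subsetI quotientS //.
    by rewrite quotient_cents2r // (subset_trans sECL).
  rewrite (quotientSK _ (subset_trans sEC nkC)).
  by rewrite (mulSGid (normal_sub (cfker_center_normal 'chi_j))).
have [lam1 Llam1 def_Z] := cfcenter_Res 'chi_j.
pose lam := 'Res[E] lam1; have Llam : lam \is a linear_char by apply: cfRes_lin_char.
have def_E : 'Res[E] 'chi_j = 'chi_j 1%g *: lam.
  by rewrite -(cfResRes _ sEZ) ?cfcenter_sub // def_Z linearZ.
have [i [k [chi_i chi_k ik_j]]] := constt_Res_conj psi_a a_j.
have Nik : 'chi_i * ('chi_k)^*%CF \is a character.
  by rewrite rpredM ?cfConjC_char ?irr_char.
have [xi Nxi def_ik] := constt_charP _ Nik ik_j.
rewrite qualifE /= irr_char /=.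
have ge1 : 1 <= 'chi_j 1%g.
  by have := irr1_gt0 j; have /natrP[n ->] := Cnat_irr1 j; rewrite ltr0n ler1n.
rewrite eq_le ge1 andbT.
have irrE i' : i' \in irr_constt ('Res[C] chi) -> 'Res[E] 'chi_i' \in irr E.
  exact: constt_Res_irr.
have: '['Res[E] ('chi_i * ('chi_k)^*%CF), lam] <= 1.
  rewrite rmorphM /= -cfAutRes cfdot_mul_conj.
  have /irrP[i' ->] := irrE i chi_i.
  have /irrP[k' ->] : 'Res[E] 'chi_k * lam \in irr E by rewrite mulrC mul_lin_irr ?irrE.
  by rewrite cfdot_irr; case: (_ == _); rewrite ?lexx ?ler01.
apply: le_trans; rewrite def_ik linearD /= cfdotDl def_E cfdotZl.
have /irrP[i' ->] := lin_char_irr Llam; rewrite cfnorm_irr.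
rewrite mulr1 lerDl natr_ge0 ?Cnat_cfdot_char ?cfRes_char ?irr_char //.
Qed.

(** Every member of [S(L)] restricts to [C] as a sum of linear characters, so [C'] lies in all their
    kernels, whose intersection is contained in [L]. *)
Lemma der1_cent_constt_ker (L E C : {group gT}) :
  E <| G -> L \subset C -> E \subset C -> C \subset constt_ker E ->
  constt_ker L \subset L -> [~: E, C] \subset L -> C^`(1)%g \subset L.
Proof.
move=> nsEG sLC sEC sCK closedL sECL.
have sCG : C \subset G := subset_trans sCK (subsetIl _ _).
apply: subset_trans closedL; rewrite subsetI (subset_trans (der_sub _ _)) //=.
apply/bigcapsP=> a aL.
have: C^`(1)%g \subset cfker ('Res[C] 'chi_a).
  rewrite (cfkerE (cfRes_char C (irr_char a))) subsetI der_sub.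
  apply/bigcapsP=> j a_j; apply: lin_char_der1.
  exact: (constt_Res_linear nsEG sLC sEC sCK sECL aL a_j).
by move/subset_trans; apply; rewrite cfker_Res ?irr_char ?subsetIr.
Qed.

End Constituents.

(** * The bound for one chief factor *)

Section ChiefStep.

Variables (gT : finGroupType) (G : {group gT}) (chi : 'CF(G)).
Hypotheses (solG : solvable G) (Nchi : chi \is a character).
Let psi := chi * chi^*%CF.
Let Npsi : psi \is a character.
Proof. by rewrite rpredM ?cfConjC_char. Qed.

Variables L E : {group gT}.
Hypotheses (nsLG : L <| G) (nsEG : E <| G) (sLE : L \subset E).
Hypothesis sE'L : [~: E, E] \subset L.
Hypothesis chiefE : forall H : {group gT},
  H <| G -> L \subset H -> H \proper E -> H \subset L.
Hypothesis closedL : constt_ker chi L \subset L.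

Let K := constt_ker chi E.
Let sEG : E \subset G := normal_sub nsEG.
Let nsKG : K <| G := constt_ker_normal chi E.
Let sKG : K \subset G := normal_sub nsKG.
Let sEK : E \subset K := sub_constt_ker chi sEG.
Let nsEK : E <| K := normalS sEK sKG nsEG.

(** Such a constituent is the restriction of a character of [K], hence [K]-invariant. *)
Lemma constt_Res_invariant (i : Iirr E) y :
  i \in irr_constt ('Res[E] chi) -> y \in K -> ('chi_i ^ y)%CF = 'chi_i.
Proof.
rewrite -(cfResRes _ sEK sKG) => /constt_Res_exists[k chi_k k_i] Ky.
have /irrP[i' def_i'] := constt_Res_irr Nchi nsEG sEK (subxx K) chi_k.
move: k_i; rewrite def_i' constt_irr inE => /eqP->.
by rewrite -def_i' (cfConjgRes _ (normal_refl K) nsEK Ky) cfConjg_id.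
Qed.

(** Some linear ['chi_j] lying under [S(L)] is moved by an element [k] of [K], and
    ['chi_i = 'chi_i' * 'chi_j] for two [K]-invariant constituents. Conjugating by [k] shows that
    the quotient of ['chi_j ^ k] by ['chi_j] stabilizes ['chi_i']. *)
Lemma ex_stabilizing_lin_char : ~~ ([~: E, K] \subset L) ->
  exists (i : Iirr E) (mu : 'CF(E)),
    [/\ i \in irr_constt ('Res[E] chi), mu \is a linear_char,
        L \subset cfker mu, 'chi_i * mu = 'chi_i & mu != 1].
Proof.
rewrite gen_subG => /subsetPn[_ /imset2P[e k Ee Kk ->]] notLek.
have Gk := subsetP sKG k Kk; have Ge := subsetP sEG e Ee.
have nEk : k \in 'N(E) by rewrite (subsetP (normal_norm nsEG)).
have Eek : [~ e, k] \in E by rewrite commgEl groupM ?groupV ?memJ_norm.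
have [a aL not_a] : exists2 a, a \in constt_over chi L & [~ e, k] \notin cfker 'chi_a.
  apply/exists_inP; apply: contraR notLek; rewrite negb_exists_in => /forall_inP z.
  apply: (subsetP closedL); rewrite inE (subsetP sEG) //=.
  by apply/bigcapP=> a /z; rewrite negbK.
have [j a_j not_j] : exists2 j, j \in irr_constt ('Res[E] 'chi_a)
                              & [~ e, k] \notin cfker 'chi_j.
  apply/exists_inP; apply: contraR not_a; rewrite negb_exists_in => /forall_inP z.
  have: [~ e, k] \in cfker ('Res[E] 'chi_a).
    rewrite cfkerE ?cfRes_char ?irr_char // inE Eek.
    by apply/bigcapP=> j /z; rewrite negbK.
  by rewrite cfker_Res ?irr_char // => /setIP[].
have [psi_a sLa] : a \in irr_constt psi /\ L \subset cfker 'chi_a.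
  by move: aL; rewrite inE => /andP[/andP[]].
have Lj : 'chi_j \is a linear_char.
  exact: (constt_Res_linear Nchi nsEG sLE (subxx E) sEK sE'L aL a_j).
have sLj : L \subset cfker 'chi_j.
  apply: subset_trans (cfker_constt (cfRes_char E (irr_char a)) a_j).
  by rewrite cfker_Res ?irr_char // subsetI sLE.
have [i [i' [chi_i chi_i' ij]]] := constt_Res_conj Nchi psi_a a_j.
have def_i : 'chi_i = 'chi_i' * 'chi_j.
  have /irrP[i2 def_i2] : 'chi_i' * 'chi_j \in irr E.
    by rewrite mulrC mul_lin_irr ?mem_irr.
  move: ij; rewrite irr_consttE cfdot_mul_conj def_i2 cfdot_irr.
  by have [-> // | _] := eqVneq i i2; rewrite eqxx.
pose mu := ('chi_j ^ k)%CF * ('chi_j)^*%CF.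
have Ljk : ('chi_j ^ k)%CF \is a linear_char by apply: cfConjg_lin_char.
have jj1 : 'chi_j * ('chi_j)^*%CF = 1.
  apply/cfun_inP=> x Ex; rewrite cfunE cfConjCE cfun1E Ex -(lin_charV_conj Lj Ex).
  by rewrite lin_charV // mulfV // lin_char_neq0.
exists i', mu; split=> //.
- by rewrite rpredM // cfConjC_lin_char.
- apply: subset_trans (cfker_mul _ _); rewrite subsetI cfker_aut sLj andbT.
  by rewrite cfker_conjg // -(normP (subsetP (normal_norm nsLG) k Gk)) conjSg.
- rewrite mulrA -{1}(constt_Res_invariant chi_i' Kk) -rmorphM /= -def_i.
  by rewrite (constt_Res_invariant chi_i Kk) def_i -mulrA jj1 mulr1.
apply: contra not_j => /eqP mu1; rewrite cfkerEirr inE.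
have jk : ('chi_j ^ k)%CF = 'chi_j.
  by rewrite -[RHS]mul1r -mu1 /mu -mulrA [_^*%CF * _]mulrC jj1 mulr1.
have jek : 'chi_j (e ^ k)%g = 'chi_j e by rewrite -{1}jk cfConjgEJ.
rewrite commgEl lin_charM ?groupV ?memJ_norm // jek lin_charV // mulVf ?lin_char_neq0 //.
by rewrite lin_char1.
Qed.

Lemma ex_max_invariant_sub : ~~ ([~: E, K] \subset L) ->
  exists R : {group gT},
    [/\ L \subset R, R \proper E, K \subset 'N(R),
        forall H : {group gT}, R \subset H -> H \proper E -> K \subset 'N(H) -> H :=: R
      & forall lam : 'CF(E), lam \is a linear_char -> R \subset cfker lam ->
          exists2 i : Iirr E, i \in irr_constt ('Res[E] chi) & 'chi_i * lam = 'chi_i].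
Proof.
case/ex_stabilizing_lin_char=> i [mu [chi_i Lmu sLmu i_mu mu1]].
(* Off [R0] the character ['chi_i] vanishes, so it is stabilized by every linear
   character trivial on [R0]. *)
pose S := [set x in E | 'chi_i x != 0]; pose R0 := <<L :|: S>>%G.
have sR0E : R0 \subset E.
  by rewrite gen_subG subUset sLE; apply/subsetP=> x; rewrite inE => /andP[].
have nR0K : K \subset 'N(R0).
  apply: norms_gen; apply: normsU; first exact: subset_trans (normal_norm nsLG).
  apply/subsetP=> k Kk; rewrite inE; apply/subsetP=> _ /imsetP[x Sx ->].
  have [Ex nzx] : x \in E /\ 'chi_i x != 0 by move: Sx; rewrite inE => /andP[].
  have nEk : k \in 'N(E) by rewrite (subsetP (normal_norm nsEG)) ?(subsetP sKG).
  by rewrite inE memJ_norm // Ex -(constt_Res_invariant chi_i Kk) cfConjgEJ.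
(* Where ['chi_i] is nonzero, ['chi_i * mu = 'chi_i] forces [mu] to be 1; as [mu != 1], this makes
   [R0] proper. *)
have sR0mu : R0 \subset cfker mu.
  rewrite gen_subG subUset sLmu; apply/subsetP=> x Sx.
  have [Ex nzx] : x \in E /\ 'chi_i x != 0 by move: Sx; rewrite inE => /andP[].
  rewrite /= cfkerEchar ?lin_charW // inE Ex lin_char1 //=.
  have /cfunP/(_ x) := i_mu; rewrite cfunE => /eqP.
  by rewrite -{2}['chi_i x]mulr1 (inj_eq (mulfI nzx)).
have prR0 : R0 \proper E.
  rewrite properE sR0E; apply: contra mu1 => sER0; apply/eqP/cfun_inP=> x Ex.
  by rewrite cfker1 ?lin_char1 ?cfun1E ?Ex // (subsetP sR0mu) ?(subsetP sER0).
pose P (H : {set gT}) := (H \proper E) && (K \subset 'N(H)).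
have [R maxR sR0R] : {R : {group gT} | maxgroup R P & R0 \subset R}.
  by apply: maxgroup_exists; rewrite /P prR0.
have [/andP[prR nRK] maxR'] := maxgroupP maxR.
exists R; split=> //.
- by apply: subset_trans sR0R; rewrite sub_gen // subsetUl.
- by move=> H sRH prH nHK; apply: maxR'; rewrite /P ?prH.
move=> lam Llam sRlam; exists i => //; apply/cfun_inP=> x Ex; rewrite cfunE.
have [-> | nzx] := eqVneq ('chi_i x) 0; first by rewrite mul0r.
have sx : x \in cfker lam.
  by apply/(subsetP sRlam)/(subsetP sR0R); rewrite mem_gen // !inE Ex nzx orbT.
by rewrite (cfker1 sx) lin_char1 // mulr1.
Qed.

Section InvariantSubgroup.

Variable R : {group gT}.
Hypotheses (sLR : L \subset R) (prR : R \proper E) (nRK : K \subset 'N(R)).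
Hypothesis maxR : forall H : {group gT},
  R \subset H -> H \proper E -> K \subset 'N(H) -> H :=: R.
Hypothesis stabR : forall lam : 'CF(E),
  lam \is a linear_char -> R \subset cfker lam ->
  exists2 i : Iirr E, i \in irr_constt ('Res[E] chi) & 'chi_i * lam = 'chi_i.

Let T := 'N_G(R)%G.
Let sKT : K \subset T. Proof. by rewrite subsetI sKG. Qed.
Let sRE : R \subset E := proper_sub prR.
Let nRE : E \subset 'N(R) := subset_trans sEK nRK.
Let nsRE : R <| E. Proof. by rewrite /normal sRE. Qed.
Let nRT : T \subset 'N(R) := subsetIr _ _.

(** Since [K] lies in [T], a [T / R]-invariant subgroup of [E / R] lifts to a [K]-invariant one, and
    maximality of [R] applies. *)
Lemma minnormal_max_invariant : minnormal (E / R) (T / R).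
Proof.
apply/mingroupP; split.
  rewrite -subG1 quotient_sub1 // proper_subn //= quotient_norms //.
  by rewrite (subset_trans (subsetIl _ _)) ?normal_norm.
move=> H /andP[ntH nHT] sHE.
have [H1 defH sRH1 sH1E] := inv_quotientS nsRE sHE.
have nsRH1 : R <| H1 := normalS sRH1 sH1E nsRE.
have nH1K : K \subset 'N(H1).
  rewrite -(quotientSGK nRK (subset_trans sRH1 (normG H1))) quotient_normG // -defH.
  exact: subset_trans (quotientS R sKT) nHT.
suff eqH1 : H1 :=: E by rewrite defH eqH1.
apply/eqP; rewrite eqEproper sH1E /=; apply: contra ntH => prH1; rewrite defH (maxR sRH1 prH1 nH1K).
by rewrite trivg_quotient.
Qed.

Let abER : abelian (E / R).
Proof. by apply: sub_der1_abelian; apply: subset_trans sE'L sLR. Qed.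

(* [R] is recovered from either kernel as its largest [K]-invariant subgroup. *)
Lemma invariant_conjugate (i j : Iirr (E / R)) g :
  i != 0 -> j != 0 -> g \in G -> 'chi_(mod_Iirr j) = ('chi_(mod_Iirr i) ^ g)%CF ->
  g \in T.
Proof.
move=> nzi nzj Gg def_j; rewrite inE Gg /= inE.
have nEg : g \in 'N(E) by rewrite (subsetP (normal_norm nsEG)).
have kerP (k : Iirr (E / R)) : k != 0 -> gcore (cfker 'chi_(mod_Iirr k)) K = R.
  move=> nzk; apply: (@maxR (gcore_group _ _)); last exact: gcore_norm.
    by rewrite /= sub_gcore // mod_IirrE // cfker_mod.
  apply: sub_proper_trans (gcore_sub _ _) _; rewrite properE cfker_sub /=.
  by rewrite subGcfker mod_Iirr_eq0.
rewrite -{2}(kerP j nzj) sub_gcore; last first.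
  by rewrite -(normP (subsetP (normal_norm nsKG) g Gg)) normJ conjSg.
by rewrite def_j cfker_conjg // conjSg mod_IirrE // cfker_mod.
Qed.

(** A linear character stabilizing a constituent ['chi_k] occurs in the product of ['chi_k] with its
    conjugate, hence under some constituent [a] of [psi]. It is trivial on [L] but not on [E], and
    by normality the same holds for [a]. *)
Lemma constt_of_quotient_irr (i : Iirr (E / R)) : i != 0 ->
  exists a, a \in constt_over chi L :\: constt_over chi E
            /\ mod_Iirr i \in irr_constt ('Res[E] 'chi_a).
Proof.
move=> nzi; set j := mod_Iirr i.
have nzj : j != 0 by rewrite mod_Iirr_eq0.
have sRj : R \subset cfker 'chi_j by rewrite mod_IirrE // cfker_mod.
have Lj : 'chi_j \is a linear_char.
  by rewrite mod_IirrE // cfMod_lin_char //; apply/char_abelianP.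
have [k chi_k kj] := stabR Lj sRj.
have psiE : 'Res[E] psi = 'Res[E] chi * ('Res[E] chi)^*%CF by rewrite rmorphM /= -cfAutRes.
have : j \in irr_constt ('Res[E] psi).
  rewrite psiE; apply: (constt_mul_conj (cfRes_char E Nchi) chi_k chi_k).
  by rewrite irr_consttE cfdot_mul_conj kj cfnorm_irr oner_neq0.
case/constt_Res_exists=> a psi_a a_j; exists a; split=> //.
have nEa : ~~ (E \subset cfker 'chi_a).
  apply: contra nzj => sEa; rewrite -subGcfker.
  apply: subset_trans (cfker_constt (cfRes_char E (irr_char a)) a_j).
  by rewrite cfker_Res ?irr_char // subsetI subxx.
have nza : a != 0 by apply: contraNneq nEa => ->; rewrite cfker_irr0.
rewrite in_setD [a \in constt_over _ E]inE (negPf nEa) andbF /= inE psi_a nza /=.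
apply: constt0_Res_cfker => //; rewrite -(cfResRes _ sLE sEG).
apply: (constt_Res_trans (cfRes_char E (irr_char a)) a_j).
have sLj : L \subset cfker 'chi_j := subset_trans sLR sRj.
suff -> : 'Res[L] 'chi_j = 1 by rewrite -irr0 constt_irr inE.
apply/cfun_inP=> x Lx; rewrite cfResE // cfun1E Lx.
by rewrite cfker1 ?lin_char1 // (subsetP sLj).
Qed.

Let m := #|constt_over chi L :\: constt_over chi E|.

(** It suffices that [T / R] has at most [m.+1] orbits on the characters of [E / R]. By Clifford's
    theorem the characters under one ['chi_a] are conjugate in [G], hence in [T]; so [a] determines
    the orbit, and the principal character adds one more. *)
Lemma invariant_sub_der : [~: T^`(600 * m.+1), E]%g \subset R.
Proof.
have sET : E \subset T := subset_trans sEK sKT.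
have nRTd n : T^`(n)%g \subset 'N(R) := subset_trans (der_sub n T) nRT.
rewrite -quotient_cents2 // quotient_der //.
have solTR : solvable (T / R) by rewrite quotient_sol // (solvableS (subsetIl _ _) solG).
have := minnormal_der solTR (quotientS R sET) minnormal_max_invariant.
apply: subset_trans; apply: (@der_subn _ (T / R)%G); rewrite leq_mul2l /=.
have /fin_all_exists[h hP] : forall i : Iirr (E / R), exists a : Iirr G,
    if i == 0 then a = 0
    else a \in constt_over chi L :\: constt_over chi E
         /\ mod_Iirr i \in irr_constt ('Res[E] 'chi_a).
  move=> i; case: eqP => [_ | /eqP nzi]; first by exists 0.
  exact: constt_of_quotient_irr.
apply: leq_trans (_ : (#|h @: setT| <= _)%N); last first.
  apply: leq_trans (_ : #|0%R |: (constt_over chi L :\: constt_over chi E)| <= _)%N.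
    apply: subset_leq_card; apply/subsetP=> _ /imsetP[i _ ->].
    have := hP i; case: eqP => [_ -> | _ [hi _]]; first by rewrite setU11.
    by rewrite setU1r.
  by rewrite cardsU1; case: (_ \notin _).
apply: leq_card_imset_factor => i j _ _ eq_h.
have [hi hj] := (hP i, hP j).
have Lh0 : 0 \notin constt_over chi L :\: constt_over chi E.
  by rewrite in_setD [0 \in constt_over _ L]inE eqxx !andbF.
have [i0 | nzi] := eqVneq i 0.
  have [-> | nzj] := eqVneq j 0; first by rewrite i0.
  rewrite i0 eqxx in hi; rewrite (negPf nzj) -eq_h in hj.
  by rewrite i0 hi in hj; case: hj; rewrite (negPf Lh0).
have [j0 | nzj] := eqVneq j 0.
  rewrite j0 eqxx in hj; rewrite (negPf nzi) eq_h in hi.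
  by rewrite j0 hj in hi; case: hi; rewrite (negPf Lh0).
rewrite (negPf nzi) in hi; rewrite (negPf nzj) -eq_h in hj.
have [[_ ai] [_ aj]] := (hi, hj).
have [g Gg def_j] : exists2 g, g \in G & 'chi_(mod_Iirr j) = ('chi_(mod_Iirr i) ^ g)%CF.
  apply/cfclassP; move: aj; rewrite (Clifford_Res_sum_cfclass nsEG ai).
  rewrite irr_consttE cfdotZl mulf_eq0 negb_or => /andP[_].
  rewrite cfdot_suml; apply: contraR => notj; rewrite big1_seq // => _ /andP[_ /cfclassP[y Gy ->]].
  rewrite -conjg_IirrE cfdot_irr; case: eqP => // eq_y; case/negP: notj.
  by rewrite -eq_y conjg_IirrE; apply/cfclassP; exists y.
have Tg := invariant_conjugate nzi nzj Gg def_j.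
have def_jq : j = conjg_Iirr i (coset R g).
  apply: (can_inj (mod_IirrK nsRE)); apply: irr_inj.
  have [nRg nEg] : g \in 'N(R) /\ g \in 'N(E).
    by rewrite (subsetP nRT) // (subsetP (normal_norm nsEG)).
  by rewrite def_j !mod_IirrE // conjg_IirrE cfConjgMod_norm.
apply/eqP; rewrite eq_sym eq_cfclass_IirrE def_jq; apply: imset_f.
exact: mem_quotient.
Qed.

End InvariantSubgroup.

(** If [S(L) = S(E)], then [E] lies in [constt_ker chi E = constt_ker chi L], hence in [L]. *)
Lemma constt_over_gt0 : L \proper E ->
  (0 < #|constt_over chi L :\: constt_over chi E|)%N.
Proof.
move=> prLE; rewrite lt0n cards_eq0 setD_eq0; apply: contraL prLE => sLE'.
have eqLE : constt_over chi L = constt_over chi E.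
  by apply/eqP; rewrite eqEsubset sLE' constt_overS.
rewrite properE negb_and negbK; apply/orP; right; apply: subset_trans closedL.
by rewrite /constt_ker eqLE.
Qed.

Lemma der_constt_ker : L \proper E ->
  K^`(1201 * #|constt_over chi L :\: constt_over chi E|)%g \subset L.
Proof.
move=> prLE; set m := #|_|.
have nLE : E \subset 'N(L) := subset_trans sEG (normal_norm nsLG).
have nLK : K \subset 'N(L) := subset_trans sKG (normal_norm nsLG).
have m0 : (0 < m)%N := constt_over_gt0 prLE.
pose H := [group of K^`(600 * m.+1)%g].
have sHK : H \subset K := der_sub _ _.
have sEHL : [~: E, H] \subset L.
  have [sEKL | notEK] := boolP ([~: E, K] \subset L).
    by apply: subset_trans sEKL; rewrite commgS.
  have [R [sLR prR nRK maxR stabR]] := ex_max_invariant_sub notEK.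
  (* [J] is normal in [G] and contained in the proper subgroup [R] of [E], so the chief factor
     condition puts it in [L]. *)
  pose J := ([~: E, H] <*> L)%G.
  have sJR : J \subset R.
    rewrite join_subG sLR andbT commGC; apply: subset_trans (invariant_sub_der sLR prR nRK maxR stabR).
    by rewrite commSg // dergS // subsetI sKG.
  have nsHG : H <| G by apply: gFnormal_trans.
  have nsJG : J <| G.
    apply: normalY => //; rewrite /normal normsR ?normal_norm // andbT.
    by rewrite (subset_trans (commg_sub _ _)) // join_subG sEG normal_sub.
  apply: subset_trans (joing_subl _ L) _.
  by apply: (chiefE nsJG); rewrite ?joing_subr // (sub_proper_trans sJR).
pose C := (K :&: coset L @*^-1 'C(E / L))%G.
have sCK : C \subset K := subsetIl _ _.
have nLC : C \subset 'N(L) := subset_trans sCK nLK.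
have sECL : [~: E, C] \subset L.
  rewrite commGC -quotient_cents2 // (sub_quotient_pre _ nLC); exact: subsetIr.
have sHC : H \subset C.
  rewrite subsetI sHK -sub_quotient_pre ?(subset_trans sHK) //.
  by rewrite quotient_cents2 ?(subset_trans sHK) // commGC.
have sEC : E \subset C.
  by rewrite subsetI sEK -sub_quotient_pre // quotient_cents2.
have sC'L : C^`(1)%g \subset L.
  exact: (der1_cent_constt_ker Nchi nsEG (subset_trans sLE sEC) sEC sCK closedL sECL).
(* The [600 * m.+1] steps into [C] and one more into [L] amount to at most [1201 * m], with equality
   for [m = 1]. *)
apply: subset_trans (der_subn _ _) (der_comp_sub sHC sC'L).
rewrite mulnS addnAC -(prednK m0); set q := m.-1.
by rewrite -[1201%N]/(600 + 1 + 600)%N mulnDl leq_add2r leq_pmulr.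
Qed.

End ChiefStep.

(** * Summation along a chain of closed subgroups *)

(** Induction on the size of [S(L)]: for a chief factor [E / L] the closed subgroup
    [K = constt_ker chi E] has [S(K) = S(E)], which is smaller, and passing from [K] to [L] costs
    1201 steps for each constituent lost. *)
Lemma der_closed_constt_ker (gT : finGroupType) (G L : {group gT}) (chi : 'CF(G)) :
  solvable G -> chi \is a character -> L <| G -> constt_ker chi L \subset L ->
  G^`(1201 * #|constt_over chi L|)%g \subset L.
Proof.
move=> solG Nchi; have [n] := ubnP #|constt_over chi L|.
elim: n => // n IHn in L *; rewrite ltnS => leLn nsLG closedL.
have [sGL | notGL] := boolP (G \subset L); first exact: subset_trans (der_sub _ _) sGL.
have nLG := normal_norm nsLG.
have ntGL : (G / L != 1)%g by rewrite -subG1 quotient_sub1.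
have [M minM sMG] := minnormal_exists ntGL (normG _).
have [nMG ntM abelM] := minnormal_solvable minM sMG (quotient_sol L solG).
have nsMG : (M <| G / L)%g by apply/andP.
have [E defM0 sLE nsEG] := inv_quotientN nsLG nsMG.
have defM : M = (E / L)%g :> {set _} by rewrite defM0.
have sEG := normal_sub nsEG; have nLE := subset_trans sEG nLG.
have sE'L : [~: E, E] \subset L.
  by apply: (der1_min nLE); rewrite -defM (abelem_abelian abelM).
have prLE : L \proper E.
  by rewrite properE sLE; apply: contra ntM => sEL; rewrite defM quotientS1.
have chiefE (H : {group gT}) : H <| G -> L \subset H -> H \proper E -> H \subset L.
  move=> nsHG sLH prHE; have nLH := subset_trans (normal_sub nsHG) nLG.
  have [HL1 | ntHL] := eqVneq (H / L)%g 1%g; first by rewrite -quotient_sub1 // HL1.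
  have [_ /(_ (H / L)%G)minM'] := mingroupP minM.
  have eqHM : (H / L)%g = M.
    apply: minM'; first by rewrite ntHL quotient_norms ?normal_norm.
    by rewrite defM quotientS // proper_sub.
  case/negP: (proper_subn prHE).
  by rewrite -(quotientSGK nLE sLH) eqHM defM.
pose K := constt_ker chi E.
have nsKG : K <| G := constt_ker_normal chi E.
have overK : constt_over chi K = constt_over chi E by apply: constt_over_ker.
have := der_constt_ker solG Nchi nsLG nsEG sLE sE'L chiefE closedL prLE.
have := constt_over_gt0 nsEG sLE closedL prLE.
set m := #|_| => m0 derK.
have cardL : #|constt_over chi L| = (#|constt_over chi E| + m)%N.
  by rewrite /m cardsD (setIidPr (constt_overS _ sLE)) subnKC // subset_leq_card ?constt_overS.
have ltKn : (#|constt_over chi K| < n)%N.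
  by rewrite overK; apply: leq_trans leLn; rewrite cardL -addn1 leq_add2l.
have closedK : constt_ker chi K \subset K by rewrite /K /constt_ker /= overK.
have := IHn K ltKn nsKG closedK; rewrite overK => derG.
by rewrite cardL mulnDr; apply: der_comp_sub derG derK.
Qed.

(** An element in the kernel of [chi * chi^*] gives [chi] the absolute value [chi 1]. *)
Lemma constt_ker1_cent (gT : finGroupType) (G : {group gT}) (chi : 'CF(G)) :
  chi \is a character -> constt_ker chi 1%g \subset 'Z(chi)%CF.
Proof.
move=> Nchi; apply/subsetP=> z Zz; have Gz := subsetP (subsetIl _ _) z Zz.
have Npsi : chi * chi^*%CF \is a character by rewrite rpredM ?cfConjC_char.
have: z \in cfker (chi * chi^*%CF).
  rewrite (cfkerE Npsi) inE Gz; apply/bigcapP=> i psi_i.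
  have [-> | nzi] := eqVneq i 0; first by rewrite cfker_irr0.
  by apply: (subsetP (constt_ker_sub (L := 1%g) _)) Zz; rewrite inE psi_i nzi sub1G.
rewrite (cfkerEchar Npsi) inE Gz /= char_cfcenterE // cfunE cfConjCE [X in _ == X]cfunE cfConjCE -!normCK.
by rewrite eqrXn2 // [`|chi 1%g|]ger0_norm ?char1_ge0.
Qed.

(** The summand 1 pays for the last step, from the closed subgroup inside ['Z(chi)] into
    [cfker chi]: the center is cyclic modulo the kernel. *)
Theorem derived_length_eta (gT : finGroupType) (G : {group gT}) (chi : 'CF(G)) :
  solvable G -> chi \in irr G ->
  (derived_length (G / cfker chi)%g <= 1201 * eta chi + 1)%N.
Proof.
move=> solG irr_chi; have Nchi := irrWchar irr_chi.
have nsZ : constt_ker chi 1%g <| G := constt_ker_normal chi 1%g.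
have closedZ : constt_ker chi (constt_ker chi 1%g) \subset constt_ker chi 1%g.
  by rewrite {1}/constt_ker constt_over_ker ?sub1G.
have eta_over : #|constt_over chi (constt_ker chi 1%g)| = eta chi.
  rewrite constt_over_ker ?sub1G //; apply: eq_card => i.
  by rewrite !inE sub1G andbT.
have derG := der_closed_constt_ker solG Nchi nsZ closedZ.
rewrite eta_over in derG.
have derZ : (constt_ker chi 1%g)^`(1)%g \subset cfker chi.
  apply: subset_trans (dergS 1 (constt_ker1_cent Nchi)) _.
  apply: der1_min; first exact: normal_norm (cfker_center_normal chi).
  exact: cyclic_abelian (cfcenter_cyclic chi).
apply/derived_length_leP; first exact: quotient_sol.
rewrite -quotient_der ?cfker_norm //.
by apply: quotientS1; apply: der_comp_sub derG derZ.
Qed.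

Theorem theoremA (R : realType) :
  exists C D : R,
    forall (gT : finGroupType) (G : {group gT}) (chi : 'CF(G)),
      solvable G -> chi \in irr G ->
      (derived_length (G / cfker chi)%g)%:R <= C * (eta chi)%:R + D.
Proof.
exists 1201%:R, 1 => gT G chi solG irr_chi.
by rewrite -natrM natr1 ler_nat -addn1 derived_length_eta.
Qed.
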